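(* Let $\Omega\subset\mathbb R^2$ be a convex, open, bounded polygonal domain, $f\in L^2(\Omega)$, $g\in H^{1/2}(\partial\Omega)$, $a_0>0$, and $a\in C^1(\partial\Omega)$ with $a\ge a_0$. Let $U_a(\eta)=u_h^{(a+\eta)}$ for $\eta$ in a neighborhood $D(U_a)$ of $0$ in $C^1(\partial\Omega)$ on which this is well defined. For $\eta\in C^1(\partial\Omega)$ let $\dot u_h^{(a)}=\dot u_h^{(a)}[\eta]\in V_h$ be the unique solution of $$b_a(\dot u_h^{(a)},v)=-\int_{\partial\Omega}\eta\,u_h^{(a)}v\,ds\quad\text{for all }v\in V_h.$$ Then the Fréchet derivative $U_a'(0):C^1(\partial\Omega)\to H^1(\Omega)$ of $U_a$ at $0$ is given by $U_a'(0)\eta=\dot u_h^{(a)}[\eta]$, i.e. $$\frac{\|U_a(\eta)-U_a(0)-\dot u_h^{(a)}[\eta]\|_{H^1(\Omega)}}{\|\eta\|_{C^1(\partial\Omega)}}\to0\quad\text{as }\|\eta\|_{C^1(\partial\Omega)}\to0.$$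
   Context: For a Robin parameter $\alpha\in C^1(\partial\Omega)$ define $b_\alpha(u,v)=\int_\Omega\nabla u\cdot\nabla v\,dx+\int_{\partial\Omega}\alpha uv\,ds$ and $\ell_{f,g}(v)=\int_{\partial\Omega}gv\,ds-\int_\Omega fv\,dx$. $\mathcal T_h$ is a triangulation of $\Omega$ into triangles forming a simplicial complex, $h=\max_{K\in\mathcal T_h}\mathrm{diam}(K)$, and $V_h=\{v\in H^1(\Omega): v|_K\in\mathbb P^1\ \forall K\in\mathcal T_h\}$. $u_h^{(\alpha)}\in V_h$ is the unique solution of $b_\alpha(u_h^{(\alpha)},v)=\ell_{f,g}(v)$ for all $v\in V_h$. *)

(* Defs.v *)
From HB Require Import structures.
From mathcomp Require Import all_boot all_order all_algebra.
From mathcomp Require Import all_classical all_reals all_analysis.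
Set Implicit Arguments. Unset Strict Implicit. Unset Printing Implicit Defensive.
Import Order.TTheory GRing.Theory Num.Theory.
Import numFieldNormedType.Exports.
Local Open Scope classical_set_scope.
Local Open Scope ring_scope.

Section RobinFEM.
Variable R : realType.
Local Notation pt := (R * R)%type.

Definition leb2 := ((@lebesgue_measure R) \x (@lebesgue_measure R))%E.

Definition I01 : set R := `[0, 1].
Definition psub (p q : pt) : pt := (p.1 - q.1, p.2 - q.2).
Definition cross (u v : pt) : R := u.1 * v.2 - u.2 * v.1.
Definition dot (u v : pt) : R := u.1 * v.1 + u.2 * v.2.
Definition enorm (u : pt) : R := Num.sqrt (dot u u).

Definition chull (A : set pt) : set pt :=
  [set x | exists (n : nat) (q : 'I_n -> pt) (l : 'I_n -> R),
     (forall k, A (q k)) /\ (forall k, 0 <= l k) /\ \sum_(k < n) l k = 1 /\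
     x = (\sum_(k < n) l k * (q k).1, \sum_(k < n) l k * (q k).2)].

Section Polygon.
Variables (N : nat) (P : 'I_N -> pt).

Definition nxt (i : 'I_N) : 'I_N := ordS i.

Definition convex_ccw_vertices : Prop :=
  forall i j : 'I_N, j != i -> j != nxt i ->
    0 < cross (psub (P (nxt i)) (P i)) (psub (P j) (P i)).

Definition Omega : set pt :=
  [set x | forall i : 'I_N, 0 < cross (psub (P (nxt i)) (P i)) (psub x (P i))].

Definition edge (i : 'I_N) (t : R) : pt :=
  ((P i).1 + t * ((P (nxt i)).1 - (P i).1), (P i).2 + t * ((P (nxt i)).2 - (P i).2)).
Definition elen (i : 'I_N) : R := enorm (psub (P (nxt i)) (P i)).

Definition bdry : set pt :=
  [set x | exists (i : 'I_N) (t : R), 0 <= t <= 1 /\ x = edge i t].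

Definition bint (F : pt -> R) : R :=
  \sum_(i < N) elen i * Rintegral (@lebesgue_measure R) I01 (fun t => F (edge i t)).

Definition L2_Omega (f : pt -> R) : Prop :=
  measurable_fun Omega f /\
  (\int[leb2]_(x in Omega) ((f x) ^+ 2)%:E < +oo)%E.

(* g in H^{1/2}(\partial Omega): L^2(\partial Omega) with finite
   Sobolev--Slobodeckij (Gagliardo) seminorm (boundary of dimension 1) *)
Definition H12_bdry (g : pt -> R) : Prop :=
  (forall i : 'I_N, measurable_fun I01 (fun t => g (edge i t))) /\
  (\sum_(i < N) (elen i)%:E *
     \int[@lebesgue_measure R]_(t in I01) ((g (edge i t)) ^+ 2)%:E < +oo)%E /\
  (\sum_(i < N) \sum_(j < N) (elen i * elen j)%:E *
     \int[@lebesgue_measure R]_(s in I01) \int[@lebesgue_measure R]_(t in I01)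
        ((g (edge i s) - g (edge j t)) ^+ 2
           / (enorm (psub (edge i s) (edge j t))) ^+ 2)%:E < +oo)%E.

(* eta in C^1(\partial Omega): continuous on the boundary (it is a single
   function of the boundary point) and C^1 up to the endpoints on each edge *)
Definition C1_bdry (eta : pt -> R) : Prop :=
  forall i : 'I_N, exists F : R -> R,
    (forall t, derivable F t 1) /\ continuous (derive1 F) /\
    (forall t, 0 <= t <= 1 -> F t = eta (edge i t)).

Definition C1_norm (eta : pt -> R) : R :=
  sup [set r | exists x, bdry x /\ r = `|eta x|] +
  sup [set r | exists (i : 'I_N) (t : R), 0 < t < 1 /\
                 r = `|derive1 (fun s => eta (edge i s)) t| / elen i].

Variables (M : nat) (T : 'I_M -> 'I_3 -> pt).

Definition ctri (K : 'I_3 -> pt) : set pt := chull (range K).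
Definition otri (K : 'I_3 -> pt) : set pt :=
  [set x | exists l : 'I_3 -> R, (forall k, 0 < l k) /\ \sum_(k < 3) l k = 1 /\
     x = (\sum_(k < 3) l k * (K k).1, \sum_(k < 3) l k * (K k).2)].

Definition triangulation : Prop :=
  (forall m : 'I_M, cross (psub (T m (inord 1)) (T m (inord 0)))
                          (psub (T m (inord 2)) (T m (inord 0))) != 0) /\
  \bigcup_(m in [set: 'I_M]) ctri (T m) = closure Omega /\
  (forall m m' : 'I_M, m != m' -> otri (T m) `&` otri (T m') = set0) /\
  (forall m m' : 'I_M,
     ctri (T m) `&` ctri (T m') = chull (range (T m) `&` range (T m'))).

(* V_h: continuous piecewise P1 functions (continuous representative on
   closure Omega, extended by 0 outside) *)
Definition Vh (v : pt -> R) : Prop :=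
  (forall m : 'I_M, exists c0 c1 c2 : R,
      forall x, ctri (T m) x -> v x = c0 + c1 * x.1 + c2 * x.2) /\
  (forall x, ~ closure Omega x -> v x = 0).

Definition grad (v : pt -> R) (x : pt) : pt :=
  ('D_((1 : R), (0 : R)) v x, 'D_((0 : R), (1 : R)) v x).

Definition bform (alpha u v : pt -> R) : R :=
  Rintegral leb2 Omega (fun x => dot (grad u x) (grad v x)) +
  bint (fun x => alpha x * u x * v x).
Definition lform (f g v : pt -> R) : R :=
  bint (fun x => g x * v x) - Rintegral leb2 Omega (fun x => f x * v x).

Definition dsol (f g alpha u : pt -> R) : Prop :=
  Vh u /\ forall v, Vh v -> bform alpha u v = lform f g v.

Definition dderiv (alpha u eta w : pt -> R) : Prop :=
  Vh w /\ forall v, Vh v -> bform alpha w v = - bint (fun x => eta x * u x * v x).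

Definition H1_norm (u : pt -> R) : R :=
  Num.sqrt (Rintegral leb2 Omega (fun x => (u x) ^+ 2) +
            Rintegral leb2 Omega (fun x => dot (grad u x) (grad u x))).

End Polygon.
End RobinFEM.

(* Main.v *)
(** [Vh] is finite-dimensional, since a function of [Vh] is determined by its
    values at the vertices of the triangles.  For [alpha >= a1 > 0] on the boundary the
    symmetric form [bform alpha] is definite on [Vh]: zero energy makes [v]
    constant on each triangle, hence on the convex polygon, and the boundary
    term forces the constant to vanish.  So the discrete problems are solvable
    for every linear right-hand side, and in particular the values at the
    vertices are represented through [bform a] (Riesz), which by Cauchy-Schwarz
    bounds the [H1] norm by the energy.

    Put [e = ueta - u0], [r = e - w] and [k = C1_norm eta].  Subtracting the
    discrete equations gives [bform a e v = - bint (eta * ueta * v)] and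
    [bform a r v = - bint (eta * e * v)].  Testing with [v = e] yields
    [|e| = O(k)] in [L2] of the boundary, then testing with [v = r] yields
    [bform a r r = O(k^4)], i.e. a remainder [O(k^2)] in [H1]. *)

Require Import Defs.
From HB Require Import structures.
From mathcomp Require Import all_boot all_order all_algebra.
From mathcomp Require Import all_classical all_reals all_analysis.
From mathcomp Require Import measurable_realfun ring lra zify.
Set Implicit Arguments.
Unset Strict Implicit.
Unset Printing Implicit Defensive.
Import Order.TTheory GRing.Theory Num.Theory.
Import numFieldNormedType.Exports.
Local Open Scope classical_set_scope.
Local Open Scope ring_scope.

(** * Definite forms on finite-dimensional spaces *)

Section LinearSolvability.
Variables (F : fieldType) (V : lmodType F) (n : nat).
Variables (S : V -> Prop) (ev : {linear V -> 'rV[F]_n}).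
Hypothesis S0 : S 0.
Hypothesis SZD : forall (c : F) u v, S u -> S v -> S (c *: u + v).
Hypothesis ev_inj : forall v, S v -> ev v = 0 -> v = 0.

Lemma subspace_sum k (c : 'I_k -> F) (e : 'I_k -> V) :
  (forall i, S (e i)) -> S (\sum_i c i *: e i).
Proof.
move=> Se; elim: k c e Se => [|k IH] c e Se; first by rewrite big_ord0.
by rewrite big_ord_recl; apply: SZD => //; apply: IH.
Qed.

(** Take a finite family in [S] whose image under [ev] has maximal rank, which is at most [n].
    Appending any [v] of [S] cannot raise the rank, so [ev v] lies in the row span, and injectivity
    of [ev] on [S] lifts this relation back to [V]. *)
Lemma finite_spanning :
  exists (k : nat) (e : 'I_k -> V), (forall i, S (e i)) /\
    forall v, S v -> exists c : 'I_k -> F, v = \sum_i c i *: e i.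
Proof.
pose Q (r : nat) := exists (k : nat) (e : 'I_k -> V),
  (forall i, S (e i)) /\ \rank (\matrix_i ev (e i)) = r.
have exQ : exists r, `[< Q r >].
  by exists (\rank (\matrix_(i < 0) ev 0)); apply/asboolP; exists 0%N, (fun=> 0).
have ubQ r : `[< Q r >] -> (r <= n)%N.
  by move=> /asboolP[k [e [_ <-]]]; exact: rank_leq_col.
case: (ex_maxnP exQ ubQ) => r /asboolP[k [e [Se rk]]] maxr.
exists k, e; split => // v Sv.
pose A : 'M[F]_(k, n) := \matrix_i ev (e i).
have vA : (ev v <= A)%MS.
  pose e' := fun i : 'I_(1 + k) =>
    match fintype.split i with inl _ => v | inr j => e j end.
  pose A' : 'M[F]_(1 + k, n) := \matrix_i ev (e' i).
  have A'E : A' = col_mx (ev v) A.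
    apply/row_matrixP => i; rewrite rowK /e'.
    case: fintype.split_ordP => j ->; last by rewrite rowKd rowK.
    by rewrite rowKu ord1; apply/rowP => l; rewrite mxE.
  have rA' : (\rank A' <= \rank A)%N.
    rewrite -/A in rk; rewrite rk; apply: maxr; apply/asboolP.
    by exists (1 + k)%N, e'; split => // i; rewrite /e'; case: (fintype.split i).
  have AA' : (A <= A')%MS.
    have : (A' <= A')%MS by [].
    by rewrite {1}A'E col_mx_sub => /andP[].
  have : (A' <= A)%MS.
    by have := mxrank_leqif_sup AA' => -[_ <-]; rewrite eqn_leq rA' mxrankS.
  by rewrite A'E col_mx_sub => /andP[].
have /submxP[c cE] := vA.
exists (c 0); have Ss := subspace_sum (c 0) Se.
apply/eqP; rewrite -subr_eq0; apply/eqP; apply: ev_inj.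
  by rewrite addrC -scaleN1r; apply: SZD.
rewrite linearB cE linear_sum mulmx_sum_row; apply/eqP; rewrite subr_eq0.
by apply/eqP; apply: eq_bigr => i _; rewrite linearZ rowK.
Qed.

(* A functional [l] factors through the Gram matrix because it kills the
   kernel of the Gram matrix, which is trivial in [V] by definiteness. *)
Lemma definite_form_solvable (b : V -> V -> F) (l : V -> F) :
  (forall c u v w, S u -> S v -> S w -> b (c *: u + v) w = c * b u w + b v w) ->
  (forall c u v w, S u -> S v -> S w -> b w (c *: u + v) = c * b w u + b w v) ->
  (forall v, S v -> b v v = 0 -> v = 0) ->
  (forall c u v, S u -> S v -> l (c *: u + v) = c * l u + l v) ->
  exists2 u, S u & forall v, S v -> b u v = l v.
Proof.
move=> bl br bdef lin.
have additive_sum (h : V -> F) k (c : 'I_k -> F) e :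
    (forall d u v, S u -> S v -> h (d *: u + v) = d * h u + h v) ->
    (forall i, S (e i)) -> h (\sum_i c i *: e i) = \sum_i c i * h (e i).
  move=> hl; have h0 : h 0 = 0.
    by have := hl (-1) 0 0 S0 S0; rewrite scaler0 addr0 mulN1r addNr.
  elim: k c e => [|k IH] c e Se; first by rewrite !big_ord0.
  by rewrite !big_ord_recl hl ?IH //; apply: subspace_sum.
have [k [e [Se spe]]] := finite_spanning.
pose G : 'M[F]_k := \matrix_(i, j) b (e i) (e j).
pose L : 'rV[F]_k := \row_j l (e j).
have : (L <= G)%MS.
  rewrite submxE; apply/eqP/rowP => j; rewrite [RHS]mxE.
  (* With a column of the cokernel of [G] as coefficients, [v] satisfies [b (e i) v = 0] for every
     [i]. Hence [b v v = 0], and definiteness applies. *)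
  pose y i := cokermx G i j; pose v := \sum_i y i *: e i.
  have Sv : S v by apply: subspace_sum.
  have Gy i : b (e i) v = 0.
    rewrite (additive_sum (b (e i))) // => [|d u w Su Sw]; last exact: br.
    have /matrixP/(_ i j) := mulmx_coker G; rewrite mxE [RHS]mxE => G0.
    by rewrite -[RHS]G0; apply: eq_bigr => m _; rewrite [G _ _]mxE mulrC.
  have v0 : v = 0.
    apply: bdef => //; rewrite {1}/v (additive_sum (b ^~ v)) //.
      by rewrite big1 // => i _; rewrite Gy mulr0.
    by move=> d u w Su Sw; exact: bl.
  have l0 : l 0 = 0.
    by have := lin (-1) 0 0 S0 S0; rewrite scaler0 addr0 mulN1r addNr.
  have /esym := additive_sum l k y e lin Se; rewrite -/v v0 l0 => ly.
  by rewrite mxE -[RHS]ly; apply: eq_bigr => m _; rewrite mxE mulrC.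
move=> /submxP[c Lc]; exists (\sum_i c 0 i *: e i); first exact: subspace_sum.
move=> v Sv; have [d ->] := spe v Sv.
rewrite (additive_sum l) // (additive_sum (b _)) //; last first.
  by move=> ? u w Su Sw; apply: br => //; apply: subspace_sum.
apply: eq_bigr => j _; congr (_ * _).
have /matrixP/(_ 0 j) := Lc; rewrite !mxE => ->.
rewrite (additive_sum (b ^~ (e j))) // => [|? u w Su Sw]; last exact: bl.
by apply: eq_bigr => m _; rewrite mxE.
Qed.

End LinearSolvability.

(** * Planar Lebesgue measure *)

Section NullSets.
Context d (T : measurableType d) (R : realType) (mu : {measure set T -> \bar R}).

Import HBNNSimple.

(** The integral of a nonnegative function is a supremum over the simple functions below it. Cutting
    such a function off on [N] keeps its integral, as it is measurable even when [g] is not. *)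
Let ge0_integral_null (N : set T) (g : T -> \bar R) :
  measurable N -> mu N = 0%E -> (forall x, 0 <= g x)%E ->
  (\int[mu]_x g x = \int[mu]_x (g \_ (~` N)) x)%E.
Proof.
move=> mN N0 g0; rewrite !ge0_integralTE //; last first.
  by move=> x; rewrite patchE; case: ifPn.
apply/le_anti/andP; split; apply: ge_ereal_sup.
  move=> _ [h hg <-].
  pose k := proj_nnsfun h (measurableC mN).
  have -> : sintegral mu h = sintegral mu k.
    rewrite -!integralT_nnsfun; apply: ae_eq_integral => //.
    - exact/measurable_EFinP.
    - exact/measurable_EFinP.
    - exists N; split => // x /= hk; apply: contrapT => Nx; apply: hk => _.
      congr EFin; transitivity (h x * \1_(~` N) x); last by [].
      by rewrite indicE mem_set // mulr1.
  apply: ereal_sup_ubound; exists k => // x.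
  change ((h x * \1_(~` N) x)%:E <= (g \_ (~` N)) x)%E; rewrite patchE indicE.
  by case: ifPn => _; rewrite ?mulr1 ?mulr0.
move=> _ [h hg <-]; apply: ereal_sup_ubound; exists h => // x.
by apply: (le_trans (hg x)); rewrite patchE; case: ifPn.
Qed.

(* The library integral is a lower integral, so changing a possibly
   non-measurable [f] on a measurable null set is harmless.  This disposes of
   [grad v] on the sides of the triangles, where it may be a junk value. *)
Lemma integral_setD_null (D N : set T) (f : T -> \bar R) :
  measurable N -> mu N = 0%E ->
  (\int[mu]_(x in D) f x = \int[mu]_(x in D `\` N) f x)%E.
Proof.
move=> mN N0; rewrite integralE [RHS]integralE.
have key (g : T -> \bar R) : (forall x, 0 <= g x)%E ->
    (\int[mu]_(x in D) g x = \int[mu]_(x in D `\` N) g x)%E.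
  move=> g0; rewrite integral_mkcond [RHS]integral_mkcond.
  rewrite (ge0_integral_null mN N0); last by move=> x; rewrite patchE; case: ifPn.
  apply: eq_integral => x _; rewrite !patchE in_setD in_setC.
  by case: (x \in N); rewrite /= ?andbF ?andbT.
by rewrite !key.
Qed.

End NullSets.

Section Plane.
Variable R : realType.
Notation mR := (measurableTypeR R).
Notation mu1 := (@lebesgue_measure R).
Notation mu2 := (@leb2 R).

Definition aff (c0 c1 c2 : R) (x : R * R) : R := c0 + c1 * x.1 + c2 * x.2.

Lemma aff_continuous c0 c1 c2 : continuous (aff c0 c1 c2).
Proof.
move=> x; apply: cvgD; first apply: cvgD; first exact: cvg_cst.
  by apply: cvgM; [exact: cvg_cst|exact: cvg_fst].
by apply: cvgM; [exact: cvg_cst|exact: cvg_snd].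
Qed.

Lemma aff_measurable c0 c1 c2 (D : set (mR * mR)) :
  measurable_fun D (aff c0 c1 c2 : mR * mR -> mR).
Proof.
have h : measurable_fun setT (aff c0 c1 c2 : mR * mR -> mR).
  apply: measurable_funD; first apply: measurable_funD => //.
    by apply: measurable_funM => //; exact: measurable_fst.
  by apply: measurable_funM => //; exact: measurable_snd.
exact: measurable_funS h.
Qed.

Lemma aff_preimage_measurable c0 c1 c2 (B : set mR) :
  measurable B -> measurable (aff c0 c1 c2 @^-1` B : set (mR * mR)).
Proof.
move=> mB; rewrite -[X in measurable X]setTI.
apply: (@aff_measurable c0 c1 c2 setT); [exact: measurableT|exact: mB].
Qed.

Lemma leb2_rect (A B : set mR) : measurable A -> measurable B ->
  mu2 (A `*` B) = (mu1 A * mu1 B)%E.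
Proof. exact: product_measure1E. Qed.

(** A vertical line is a product of a point and the real axis, of measure 0 by the convention that 0
    times infinity is 0. On any other line every vertical section is a single point, and Fubini
    applies. *)
Lemma leb2_line c0 c1 c2 : (c1 != 0) || (c2 != 0) ->
  mu2 [set x | aff c0 c1 c2 x = 0] = 0%E.
Proof.
move=> c12.
have mL : measurable ([set x | aff c0 c1 c2 x = 0] : set (mR * mR)).
  exact: (aff_preimage_measurable c0 c1 c2 (measurable_set1 0)).
have [c20|c2N0] := eqVneq c2 0.
  rewrite c20 eqxx orbF in c12.
  have -> : [set x | aff c0 c1 c2 x = 0] = [set - c0 / c1] `*` setT.
    apply/seteqP; split => -[x y]; rewrite /aff /= c20 mul0r addr0.
      move=> h; split => //=; have <- : x * c1 = - c0 by lra.
      by rewrite mulfK.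
    move=> [/= hx _]; rewrite hx; field; exact: c12.
  rewrite leb2_rect; [|exact: measurable_set1|exact: measurableT].
  by rewrite lebesgue_measure_set1 mul0e.
rewrite /leb2 /product_measure1 /= integral0_eq // => x _.
rewrite (_ : xsection _ _ = [set - (c0 + c1 * x) / c2]) ?lebesgue_measure_set1 //.
apply/seteqP; split => y; rewrite xsectionE /aff /=.
  move=> h /=; have <- : y * c2 = - (c0 + c1 * x) by lra.
  by rewrite mulfK.
move=> /= hy; rewrite hy; field; exact: c2N0.
Qed.

Lemma leb2_open_gt0 (U : set (mR * mR)) : measurable U ->
  open (U : set (R * R)) -> U !=set0 -> (0 < mu2 U)%E.
Proof.
move=> mU oU [x Ux].
have [e /= e0 eU] : exists2 e : R, 0 < e & ball x e `<=` U.
  by have /nbhs_ballP[e e0 eU] : nbhs x U := oU _ Ux; exists e.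
have mI (a : R) : mu1 `](a - e), (a + e)[ = (e + e)%:E.
  rewrite lebesgue_measure_itv /= lte_fin ltrBlDr -addrA ltrDl addr_gt0 //.
  by congr EFin; lra.
apply: (@lt_le_trans _ _ (mu2 (`](x.1 - e), (x.1 + e)[ `*` `](x.2 - e), (x.2 + e)[))).
  rewrite leb2_rect // !mI.
  by rewrite mule_gt0 // lte_fin addr_gt0.
apply: le_measure; rewrite ?inE //; first exact: measurableX.
move=> -[y z] [/= hy hz]; apply: eU; split => /=; rewrite /ball /= ltr_distlC.
  by move: hy; rewrite in_itv.
by move: hz; rewrite in_itv.
Qed.

Lemma leb2_bounded_lty (U : set (mR * mR)) (r : R) : measurable U ->
  (forall x, U x -> `|x.1| <= r /\ `|x.2| <= r) -> (mu2 U < +oo)%E.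
Proof.
move=> mU bU.
have mI : (mu1 `[(- r)%R, r] < +oo)%E.
  by rewrite lebesgue_measure_itv /=; case: ifP => _; rewrite ?ltry // -EFinD ltry.
apply: (@le_lt_trans _ _ (mu2 (`[(- r)%R, r] `*` `[(- r)%R, r]))).
  apply: le_measure; rewrite ?inE //; first exact: measurableX.
  by move=> x /bU[h1 h2]; split; rewrite /= in_itv /= -ler_norml.
rewrite leb2_rect //; apply: lte_mul_pinfty => //.
by rewrite ge0_fin_numE.
Qed.

End Plane.

Lemma bigcup_finE (I : finType) (T : Type) (F : I -> set T) :
  \bigcup_i F i = \big[setU/set0]_i F i.
Proof.
apply/seteqP; split => x; first by move=> [i _ Fx]; rewrite (bigD1 i) //; left.
by elim/big_ind: _ => // [A B IA IB [/IA|/IB]|i _ Fx] //; exists i.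
Qed.

Lemma negligible_fin_bigcup d (T : measurableType d) (R : realType)
    (mu : {measure set T -> \bar R}) (I : finType) (F : I -> set T) :
  (forall i, mu.-negligible (F i)) -> mu.-negligible (\bigcup_i F i).
Proof.
move=> F0; rewrite bigcup_finE; elim/big_ind: _ => // [|A B A0 B0].
  exact: negligible_set0.
exact: negligibleU.
Qed.

Lemma measurable_fun_fin_bigcup d (T : measurableType d) d'
    (T' : measurableType d') (I : finType)
    (F : I -> set T) (f : T -> T') :
  (forall i, measurable (F i)) -> (forall i, measurable_fun (F i) f) ->
  measurable_fun (\bigcup_i F i) f.
Proof.
move=> mF mf; suff [] : measurable (\bigcup_i F i) /\ measurable_fun (\bigcup_i F i) f.
  by [].
rewrite bigcup_finE; elim/big_ind: _ => //.
- by split; [exact: measurable0|exact: measurable_fun_set0].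
- move=> A B [mA fA] [mB fB]; split; first exact: measurableU.
  by apply/measurable_funU.
Qed.

(** * Affine functions on the plane *)

Section AffineFunctions.
Variable R : realType.

Lemma aff_convex_comb n (c0 c1 c2 : R) (q : 'I_n -> R * R) (l : 'I_n -> R) :
  \sum_k l k = 1 ->
  aff c0 c1 c2 (\sum_k l k * (q k).1, \sum_k l k * (q k).2) =
  \sum_k l k * aff c0 c1 c2 (q k).
Proof.
move=> l1; rewrite /aff /= -[X in X + _ + _]mulr1 -l1 !mulr_sumr -!big_split /=.
by apply: eq_bigr => k _; ring.
Qed.

Lemma chull_aff_ge0 (A : set (R * R)) c0 c1 c2 :
  (forall x, A x -> 0 <= aff c0 c1 c2 x) ->
  forall x, chull A x -> 0 <= aff c0 c1 c2 x.
Proof.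
move=> A0 _ [n [q [l [Aq [l0 [l1 ->]]]]]]; rewrite aff_convex_comb //.
by apply: sumr_ge0 => k _; rewrite mulr_ge0 // A0.
Qed.

Lemma cross_aff (p q x : R * R) :
  cross (psub q p) (psub x p) =
  aff (cross p q) (p.2 - q.2) (q.1 - p.1) x.
Proof. by rewrite /cross /aff /psub /=; ring. Qed.

Lemma aff_segment (c0 c1 c2 t : R) (x y : R * R) :
  aff c0 c1 c2 ((1 - t) * x.1 + t * y.1, (1 - t) * x.2 + t * y.2) =
  (1 - t) * aff c0 c1 c2 x + t * aff c0 c1 c2 y.
Proof. by rewrite /aff /=; ring. Qed.

Lemma open_aff_gt0 (c0 c1 c2 : R) : open [set x | 0 < aff c0 c1 c2 x].
Proof.
rewrite (_ : [set x | _] = aff c0 c1 c2 @^-1` [set y | y > 0]) //.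
by apply: open_comp => [x _|]; [exact: aff_continuous|exact: open_gt].
Qed.

Lemma closed_aff_ge0 (c0 c1 c2 : R) : closed [set x | 0 <= aff c0 c1 c2 x].
Proof.
rewrite (_ : [set x | _] = aff c0 c1 c2 @^-1` [set y | y >= 0]) //.
by apply: preimage_closed => [x _|]; [exact: aff_continuous|exact: closed_ge].
Qed.

(** If the function vanished at [x], a short step from [x] against its gradient [(c1, c2)] would
    stay in [U] and reach a negative value. *)
Lemma open_aff_ge0_gt0 (U : set (R * R)) (c0 c1 c2 : R) :
  (c1 != 0) || (c2 != 0) -> open U ->
  (forall x, U x -> 0 <= aff c0 c1 c2 x) ->
  forall x, U x -> 0 < aff c0 c1 c2 x.
Proof.
move=> c12 oU U0 x Ux; rewrite lt_neqAle U0 // andbT eq_sym; apply/eqP => x0.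
pose f (t : R) := (x.1 - t * c1, x.2 - t * c2).
have cf : f t @[t --> 0] --> x.
  have line_cvg (y c : R) : y - t * c @[t --> 0] --> y.
    rewrite -[X in _ --> X]subr0 -[X in _ - X](mul0r c).
    by apply: cvgB; [exact: cvg_cst|apply: cvgM; [exact: cvg_id|exact: cvg_cst]].
  exact: (cvg_pair (line_cvg x.1 c1) (line_cvg x.2 c2)).
have : \forall t \near 0^'+, U (f t).
  apply: (cvg_at_right_filter (x := 0) cf); exact: open_nbhs_nbhs.
move=> Uf; near (0 : R)^'+ => t.
have : U (f t) by near: t.
move=> /U0; have t0 : 0 < t by near: t; exact: nbhs_right_gt.
have -> : aff c0 c1 c2 (f t) = aff c0 c1 c2 x - t * (c1 ^+ 2 + c2 ^+ 2).
  by rewrite /aff /f /=; ring.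
rewrite x0 sub0r oppr_ge0 leNgt mulr_gt0 //.
rewrite lt_neqAle addr_ge0 ?sqr_ge0 // andbT eq_sym paddr_eq0 ?sqr_ge0 //.
by rewrite !sqrf_eq0 negb_and.
Unshelve. all: by end_near.
Qed.

Lemma grad_near_aff (v : R * R -> R) (c0 c1 c2 : R) (x : R * R) :
  (\forall y \near x, v y = aff c0 c1 c2 y) -> grad v x = (c1, c2).
Proof.
move=> va; rewrite /grad !(near_eq_derive _ va).
have D (w : R * R) : 'D_w (aff c0 c1 c2) x = c1 * w.1 + c2 * w.2.
  rewrite /derive; apply: cvg_lim => //.
  apply: cvg_near_cst; near=> h.
  have h0 : h != 0 by near: h; exact: nbhs_dnbhs_neq.
  rewrite /= /aff /=.
  change (h^-1 * (c0 + c1 * (h * w.1 + x.1) + c2 * (h * w.2 + x.2) -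
    (c0 + c1 * x.1 + c2 * x.2)) = c1 * w.1 + c2 * w.2).
  by field.
rewrite !D /=; congr (_, _); ring.
Unshelve. all: by end_near.
Qed.

End AffineFunctions.

Lemma ord3_ind (Q : 'I_3 -> Prop) :
  Q (inord 0) -> Q (inord 1) -> Q (inord 2) -> forall k, Q k.
Proof.
move=> Q0 Q1 Q2 [[|[|[|//]]] k3].
- by rewrite (_ : Ordinal _ = inord 0) //; apply: val_inj; rewrite /= inordK.
- by rewrite (_ : Ordinal _ = inord 1) //; apply: val_inj; rewrite /= inordK.
- by rewrite (_ : Ordinal _ = inord 2) //; apply: val_inj; rewrite /= inordK.
Qed.

Lemma sum_ord3 (V : nmodType) (F : 'I_3 -> V) :
  \sum_k F k = F (inord 0) + F (inord 1) + F (inord 2).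
Proof.
rewrite !big_ord_recl big_ord0 addr0 addrA.
by congr (F _ + F _ + F _); apply: val_inj; rewrite /= inordK.
Qed.

Lemma ordS_inord0 : ordS (inord 0 : 'I_3) = inord 1.
Proof. by apply: val_inj; rewrite /= !inordK. Qed.
Lemma ordS_inord1 : ordS (inord 1 : 'I_3) = inord 2.
Proof. by apply: val_inj; rewrite /= !inordK. Qed.
Lemma ordS_inord2 : ordS (inord 2 : 'I_3) = inord 0.
Proof. by apply: val_inj; rewrite /= !inordK. Qed.
Definition ordS3E := (ordS_inord0, ordS_inord1, ordS_inord2).

(** * Barycentric coordinates of a triangle *)

Section Triangle.
Variables (R : realType) (K : 'I_3 -> R * R).

(** Twice the signed area; the sign records the orientation of the vertices, which a triangulation
    leaves free. *)
Definition triarea2 : R :=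
  cross (psub (K (inord 1)) (K (inord 0))) (psub (K (inord 2)) (K (inord 0))).
Hypothesis K_nondeg : triarea2 != 0.

(** The gradient of the barycentric coordinate of vertex [k], by Cramer's rule. The other two
    vertices are reached cyclically through [ordS]. *)
Definition gbary (k : 'I_3) : R * R :=
  (((K (ordS k)).2 - (K (ordS (ordS k))).2) / triarea2,
   ((K (ordS (ordS k))).1 - (K (ordS k)).1) / triarea2).
Definition bary (k : 'I_3) : R * R -> R :=
  aff (cross (K (ordS k)) (K (ordS (ordS k))) / triarea2) (gbary k).1 (gbary k).2.

Lemma sum_bary x : \sum_k bary k x = 1.
Proof.
rewrite sum_ord3 /bary /gbary /aff /= !ordS3E; move: K_nondeg.
by rewrite /triarea2 /cross /psub /= => h; field.
Qed.

Lemma bary_comb x :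
  x = (\sum_k bary k x * (K k).1, \sum_k bary k x * (K k).2).
Proof.
rewrite !sum_ord3 /bary /gbary /aff /= !ordS3E; move: K_nondeg.
rewrite /triarea2 /cross /psub /= => h; rewrite [LHS]surjective_pairing.
by congr (_, _); field.
Qed.

Lemma bary_vertex k j : bary k (K j) = (k == j)%:R.
Proof.
move: K_nondeg; rewrite /bary /gbary /aff /triarea2 /cross /psub /= => h.
elim/ord3_ind: k; elim/ord3_ind: j; rewrite ?ordS3E;
  rewrite -val_eqE /= !inordK //=; by field.
Qed.

Lemma bary_vertex_comb (l : 'I_3 -> R) k : \sum_j l j = 1 ->
  bary k (\sum_j l j * (K j).1, \sum_j l j * (K j).2) = l k.
Proof.
move=> l1; rewrite /bary aff_convex_comb // -/(bary k).
rewrite (bigD1 k) //= -/(bary k _) bary_vertex eqxx mulr1 big1 ?addr0 // => j jk.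
by rewrite -/(bary k _) bary_vertex eq_sym (negbTE jk) mulr0.
Qed.

(** Each coordinate is affine with values 0 and 1 at the vertices, and every point is the
    combination of the vertices weighted by its coordinates. The description by half-planes is what
    yields closedness and measurability. *)
Lemma ctriE : ctri K = [set x | forall k, 0 <= bary k x].
Proof.
apply/seteqP; split => x /=.
  move=> Kx k; apply: chull_aff_ge0 Kx => _ [j _ <-].
  by rewrite -/(bary k _) bary_vertex ler0n.
move=> x0; exists 3%N, K, (bary^~ x); split; first by move=> k; exists k.
by split => //; split; [exact: sum_bary|exact: bary_comb].
Qed.

Lemma otriE : otri K = [set x | forall k, 0 < bary k x].
Proof.
apply/seteqP; split => x /=.
  by move=> [l [l0 [l1 ->]]] k; rewrite bary_vertex_comb.
move=> x0; exists (bary^~ x); split => //.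
by split; [exact: sum_bary|exact: bary_comb].
Qed.

Lemma vertex_ctri k : ctri K (K k).
Proof. by rewrite ctriE => j /=; rewrite bary_vertex ler0n. Qed.

Lemma sub_otri_ctri : otri K `<=` ctri K.
Proof. by rewrite otriE ctriE => x x0 k; exact/ltW/x0. Qed.

Lemma otri_nonempty : otri K !=set0.
Proof.
exists (\sum_(k < 3) 3^-1 * (K k).1, \sum_(k < 3) 3^-1 * (K k).2).
exists (fun=> 3^-1); split => //; split => //.
by rewrite sum_ord3; field.
Qed.

Lemma bigcap_ord3E (p : 'I_3 -> R * R -> Prop) :
  [set x | forall k, p k x] = \bigcap_(k in [set: 'I_3]) [set x | p k x].
Proof. by apply/seteqP; split => x h k; [move=> _|]; apply: h. Qed.

Lemma open_otri : open (otri K).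
Proof.
rewrite otriE openE => x x0; rewrite /interior.
have := @filter_forall _ 'I_3 (fun k y => 0 < bary k y) (nbhs x) _; apply => k.
by apply: open_nbhs_nbhs; split; [exact: open_aff_gt0|exact: x0].
Qed.

Lemma closed_ctri : closed (ctri K).
Proof.
rewrite ctriE bigcap_ord3E; apply: closed_bigI => k _.
exact: closed_aff_ge0.
Qed.

Notation mR := (measurableTypeR R).
Lemma measurable_otri : measurable (otri K : set (mR * mR)).
Proof.
rewrite otriE bigcap_ord3E; apply: fin_bigcap_measurable => // k _.
rewrite (_ : [set x | _] = bary k @^-1` `]0, +oo[); last first.
  by apply/seteqP; split => x /=; rewrite in_itv /= andbT.
exact: aff_preimage_measurable.
Qed.

Lemma measurable_ctri : measurable (ctri K : set (mR * mR)).
Proof.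
rewrite ctriE bigcap_ord3E; apply: fin_bigcap_measurable => // k _.
rewrite (_ : [set x | _] = bary k @^-1` `[0, +oo[); last first.
  by apply/seteqP; split => x /=; rewrite in_itv /= andbT.
exact: aff_preimage_measurable.
Qed.

(** A coordinate with zero gradient would be constant, yet it is 1 at its own vertex and 0 at the
    next one. *)
Lemma gbary_neq0 k : ((gbary k).1 != 0) || ((gbary k).2 != 0).
Proof.
rewrite -negb_and; apply/negP => /andP[/eqP g1 /eqP g2].
have b0 x : bary k x = bary k (K k) by rewrite /bary /aff g1 g2 !mul0r.
have := b0 (K (ordS k)); rewrite !bary_vertex eqxx.
elim/ord3_ind: k {g1 g2 b0} => /eqP; rewrite !ordS3E -val_eqE /= !inordK //=;
  by rewrite eq_sym oner_eq0.
Qed.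

Lemma ctri_diff_otri_null : leb2 (ctri K `\` otri K) = 0%E.
Proof.
apply: measure_negligible.
  by apply: measurableD; [exact: measurable_ctri|exact: measurable_otri].
pose L k : set (mR * mR) := [set x | bary k x = 0].
have L0 : (@leb2 R).-negligible (\bigcup_k L k).
  apply: negligible_fin_bigcup => k; apply/negligibleP.
    exact: (aff_preimage_measurable _ _ _ (measurable_set1 0)).
  by apply: leb2_line; exact: gbary_neq0.
apply: negligibleS L0; rewrite ctriE otriE => x [x0 /= /existsNP[k /negP]].
by rewrite -leNgt => xk; exists k => //; apply/le_anti; rewrite xk x0.
Qed.

End Triangle.

(** * The polygon and its triangulation *)

Section ConvexPolygon.
Variables (R : realType) (N : nat) (P : 'I_N -> R * R).
Hypothesis N3 : (3 <= N)%N.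
Hypothesis P_convex : convex_ccw_vertices P.
Notation mR := (measurableTypeR R).

Let side i x := cross (psub (P (nxt i)) (P i)) (psub x (P i)).

(** Supplies a vertex strictly to the left of edge [i], the source of nondegenerate edges and of
    interior points. *)
Lemma third_vertex (i : 'I_N) : exists j : 'I_N, (j != i) && (j != nxt i).
Proof.
apply/existsP; rewrite -[X in is_true X]negbK; apply/negP => /existsPn h.
have : (#|'I_N| <= #|[:: i; nxt i]|)%N.
  apply/subset_leq_card/fintype.subsetP => j _; have := h j.
  by rewrite negb_and !negbK !in_cons orbF.
by move=> /leq_trans/(_ (card_size _)); rewrite card_ord /=; lia.
Qed.

Lemma side_vertex_ge0 i j : 0 <= side i (P j).
Proof.
rewrite /side; have [->|ji] := eqVneq j i.
  by rewrite /cross /psub /= !subrr !mulr0 subrr.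
have [->|jn] := eqVneq j (nxt i); last exact/ltW/P_convex.
by rewrite /cross mulrC subrr.
Qed.

Lemma vertex_neq i : P (nxt i) != P i.
Proof.
have [j /andP[ji jn]] := third_vertex i.
have := P_convex ji jn; apply: contraTneq => ->.
by rewrite /cross /psub /= !subrr !mul0r subrr ltxx.
Qed.

Lemma elen_gt0 i : 0 < elen P i.
Proof.
have : psub (P (nxt i)) (P i) != 0.
  apply: contraNneq (vertex_neq i) => -[/eqP + /eqP]; rewrite !subr_eq0.
  move=> /eqP h1 /eqP h2.
  by rewrite [X in X == _]surjective_pairing h1 h2 -surjective_pairing.
move=> p0; rewrite /elen /enorm sqrtr_gt0 /dot /psub /= -!expr2.
rewrite lt_neqAle addr_ge0 ?sqr_ge0 // andbT eq_sym paddr_eq0 ?sqr_ge0 //.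
by rewrite !sqrf_eq0 -xpair_eqE; exact: p0.
Qed.

(** The witness is the mean of the vertices: its value of each [side i] averages nonnegative
    numbers, one of them positive by [third_vertex]. *)
Lemma Omega_nonempty : Omega P !=set0.
Proof.
pose c := (\sum_(j < N) N%:R^-1 * (P j).1, \sum_(j < N) N%:R^-1 * (P j).2).
have N0 : N%:R != 0 :> R by rewrite pnatr_eq0; lia.
exists c => i; rewrite cross_aff aff_convex_comb; last first.
  by rewrite sumr_const card_ord -[LHS]mulr_natr mulVf.
have [j /andP[ji jn]] := third_vertex i.
rewrite (bigD1 j) //= ltr_pwDl //.
  by rewrite -cross_aff mulr_gt0 ?P_convex // invr_gt0 ltr0n; lia.
apply: sumr_ge0 => k _; rewrite -cross_aff mulr_ge0 ?invr_ge0 ?ler0n //.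
exact: side_vertex_ge0.
Qed.

Lemma measurable_Omega : measurable (Omega P : set (mR * mR)).
Proof.
have -> : Omega P = \bigcap_i [set x | 0 < side i x].
  by apply/seteqP; split => x h i; [move=> _|]; apply: h.
apply: fin_bigcap_measurable => // i _.
rewrite (_ : [set x | _] = aff (cross (P i) (P (nxt i)))
  ((P i).2 - (P (nxt i)).2) ((P (nxt i)).1 - (P i).1) @^-1` `]0, +oo[).
  exact: aff_preimage_measurable.
by apply/seteqP; split => x /=; rewrite /side cross_aff in_itv /= andbT.
Qed.

Definition segpt (x y : R * R) (t : R) : R * R :=
  ((1 - t) * x.1 + t * y.1, (1 - t) * x.2 + t * y.2).

Lemma segpt_continuous x y : continuous (segpt x y).
Proof.
have c (a b : R) : continuous (fun t : R => (1 - t) * a + t * b).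
  move=> t; apply: cvgD; (apply: cvgM; last exact: cvg_cst).
    by apply: cvgB; [exact: cvg_cst|exact: cvg_id].
  exact: cvg_id.
by move=> t; exact: (cvg_pair (c _ _ t) (c _ _ t)).
Qed.

Lemma segpt0 x y : segpt x y 0 = x.
Proof. by rewrite /segpt subr0 !mul1r !mul0r !addr0 -surjective_pairing. Qed.

Lemma segpt1 x y : segpt x y 1 = y.
Proof. by rewrite /segpt subrr !mul1r !mul0r !add0r -surjective_pairing. Qed.

Lemma side_segpt i x y t :
  side i (segpt x y t) = (1 - t) * side i x + t * side i y.
Proof. by rewrite /side !cross_aff /segpt aff_segment. Qed.

Lemma closure_OmegaE : closure (Omega P) = [set x | forall i, 0 <= side i x].
Proof.
apply/seteqP; split => x.
  move=> xO i; rewrite /side cross_aff.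
  have /closure_id := @closed_aff_ge0 R (cross (P i) (P (nxt i)))
    ((P i).2 - (P (nxt i)).2) ((P (nxt i)).1 - (P i).1).
  set A := [set _ | _] => AE; suff : A x by [].
  rewrite AE; apply: closureS xO => y yO; rewrite /A /= -cross_aff.
  exact/ltW/yO.
move=> x0 B Bx; have [c cO] := Omega_nonempty.
(* A point [x] with nonnegative sides is approached along the segment towards an interior point [c],
   on which all sides are positive for small [t > 0]. *)
have cf : segpt x c t @[t --> 0] --> x.
  by rewrite -[X in _ --> X](segpt0 x c); exact: segpt_continuous.
have Bt : \forall t \near 0^'+, B (segpt x c t).
  exact: (cvg_at_right_filter (x := 0) cf).
near (0 : R)^'+ => t; exists (segpt x c t); split; last by near: t.
have t0 : 0 < t by near: t; exact: nbhs_right_gt.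
have t1 : t < 1 by near: t; exact: nbhs_right_lt.
move=> i; rewrite -/(side i _) side_segpt ltr_wpDl //.
  by rewrite mulr_ge0 ?x0 // subr_ge0 ltW.
by rewrite mulr_gt0 //; exact: cO.
Unshelve. all: by end_near.
Qed.

Lemma closure_Omega_segpt x y t : 0 <= t <= 1 ->
  closure (Omega P) x -> closure (Omega P) y -> closure (Omega P) (segpt x y t).
Proof.
rewrite closure_OmegaE => /andP[t0 t1] x0 y0 i; rewrite side_segpt.
by rewrite addr_ge0 // mulr_ge0 // ?subr_ge0 //.
Qed.

Lemma edge_segpt i : edge P i = segpt (P i) (P (nxt i)).
Proof. by apply/funext => t; congr (_, _) => /=; ring. Qed.

Lemma edge_closure i t : 0 <= t <= 1 -> closure (Omega P) (edge P i t).
Proof.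
move=> t01; rewrite edge_segpt; apply: closure_Omega_segpt => //;
  by rewrite closure_OmegaE => j; exact: side_vertex_ge0.
Qed.

Lemma open_sub_closure_Omega (U : set (R * R)) :
  open U -> U `<=` closure (Omega P) -> U `<=` Omega P.
Proof.
move=> oU UO x Ux i; rewrite cross_aff.
apply: (open_aff_ge0_gt0 _ oU) Ux => [|y /UO].
  rewrite -negb_and; apply: contra (vertex_neq i) => /andP[/eqP h1 /eqP h2].
  by rewrite [X in X == _]surjective_pairing [X in _ == X]surjective_pairing;
     apply/eqP; congr (_, _); lra.
by rewrite closure_OmegaE => /(_ i); rewrite /side cross_aff.
Qed.

Variables (M : nat) (T : 'I_M -> 'I_3 -> R * R).
Hypothesis T_tri : triangulation P T.

Lemma tri_nondeg m : triarea2 (T m) != 0.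
Proof. by have [+ _] := T_tri; apply. Qed.

Lemma cover_ctri : \bigcup_m ctri (T m) = closure (Omega P).
Proof. by have [_ [+ _]] := T_tri. Qed.

Lemma ctri_closure m : ctri (T m) `<=` closure (Omega P).
Proof. by move=> x xm; rewrite -cover_ctri; exists m. Qed.

Lemma otri_Omega m : otri (T m) `<=` Omega P.
Proof.
apply: open_sub_closure_Omega; first exact/open_otri/tri_nondeg.
by move=> x /(sub_otri_ctri (tri_nondeg m)); exact: ctri_closure.
Qed.

Lemma Omega_diff_otri_null : leb2 (Omega P `\` \bigcup_m otri (T m)) = 0%E.
Proof.
apply: measure_negligible.
  apply: measurableD; first exact: measurable_Omega.
  by apply: fin_bigcup_measurable => // m _; exact: measurable_otri (tri_nondeg m).
have L0 : (@leb2 R).-negligible (\bigcup_m (ctri (T m) `\` otri (T m))).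
  apply: negligible_fin_bigcup => m; apply/negligibleP.
    apply: measurableD; [exact: measurable_ctri (tri_nondeg m)|].
    exact: measurable_otri (tri_nondeg m).
  exact/ctri_diff_otri_null/tri_nondeg.
apply: negligibleS L0 => x [/subset_closure]; rewrite -cover_ctri.
by move=> [m _ xm] xn; exists m => //; split => // xo; apply: xn; exists m.
Qed.

(** Boundedness is read off the triangulation: points of the finitely many covering triangles are
    convex combinations of vertices, whose coordinates are at most [r] in absolute value. *)
Lemma leb2_Omega_lty : (leb2 (Omega P) < +oo)%E.
Proof.
pose r := \sum_m \sum_k (`|(T m k).1| + `|(T m k).2|).
apply: (@leb2_bounded_lty _ _ r); first exact: measurable_Omega.
have comb m k : `|(T m k).1| <= r /\ `|(T m k).2| <= r.
  have : `|(T m k).1| + `|(T m k).2| <= r.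
    rewrite /r (bigD1 m) //= (bigD1 k) //= -addrA lerDl addr_ge0 //.
      by apply: sumr_ge0 => *; rewrite addr_ge0.
    by apply: sumr_ge0 => *; apply: sumr_ge0 => *; rewrite addr_ge0.
  have := normr_ge0 (T m k).1; have := normr_ge0 (T m k).2; lra.
move=> x /subset_closure; rewrite -cover_ctri => -[m _ [n [q [l [qT [l0 [l1 ->]]]]]]].
suff H (f : R * R -> R) : (forall k, `|f (T m k)| <= r) ->
    `|\sum_(k < n) l k * f (q k)| <= r.
  by split; apply: H => k; case: (comb m k).
move=> fr; rewrite -[leRHS]mul1r -l1 mulr_suml.
apply: (le_trans (ler_norm_sum _ _ _)); apply: ler_sum => k _.
rewrite normrM ger0_norm // ler_wpM2l //.
by have [j _ <-] := qT k; exact: fr.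
Qed.

(** * Pointwise properties of finite element functions *)

Section FiniteElementFunction.
Variable v : R * R -> R.
Hypothesis Vv : Vh P T v.

(** The constant gradient on triangle [m], expressed through nodal values so that it is linear in
    [v] without a choice of affine coefficients. *)
Definition gradK m : R * R :=
  (\sum_k v (T m k) * (gbary (T m) k).1, \sum_k v (T m k) * (gbary (T m) k).2).

Lemma Vh_bary m x : ctri (T m) x -> v x = \sum_k bary (T m) k x * v (T m k).
Proof.
have [+ _] := Vv => /(_ m)[c0 [c1 [c2 va]]] xm; rewrite va //.
have l1 := sum_bary (tri_nondeg m) x.
rewrite -/(aff c0 c1 c2 x) [X in aff _ _ _ X](bary_comb (tri_nondeg m)).
rewrite aff_convex_comb //; apply: eq_bigr => k _.
by rewrite [in RHS]va //; apply/vertex_ctri/tri_nondeg.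
Qed.

Lemma Vh_aff m : exists c0, forall x, ctri (T m) x ->
  v x = aff c0 (gradK m).1 (gradK m).2 x.
Proof.
exists (\sum_k v (T m k) *
  (cross (T m (ordS k)) (T m (ordS (ordS k))) / triarea2 (T m))).
move=> x /Vh_bary ->; rewrite /aff /= !mulr_suml -!big_split /=.
by apply: eq_bigr => k _; rewrite /bary /aff /gbary /=; ring.
Qed.

Lemma Vh_grad m x : otri (T m) x -> grad v x = gradK m.
Proof.
move=> xm; have [c0 va] := Vh_aff m.
rewrite (grad_near_aff (c0 := c0) (c1 := (gradK m).1) (c2 := (gradK m).2)).
  by rewrite -surjective_pairing.
have : nbhs x (otri (T m)).
  by apply: open_nbhs_nbhs; split => //; exact/open_otri/tri_nondeg.
by apply: filterS => y ym; apply: va; exact: (sub_otri_ctri (tri_nondeg m)).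
Qed.

Lemma Vh_bounded x : closure (Omega P) x ->
  `|v x| <= \sum_m \sum_k `|v (T m k)|.
Proof.
rewrite -cover_ctri => -[m _ xm]; rewrite (Vh_bary xm) (bigD1 m) //=.
rewrite ler_wpDr //; first by apply: sumr_ge0 => *; apply: sumr_ge0 => *.
apply: (le_trans (ler_norm_sum _ _ _)); apply: ler_sum => k _.
have x0 : forall j, 0 <= bary (T m) j x by move: xm; rewrite (ctriE (tri_nondeg m)).
rewrite normrM ger0_norm // ler_piMl //.
rewrite -(sum_bary (tri_nondeg m) x) (bigD1 k) //= lerDl.
exact: sumr_ge0.
Qed.

Lemma Vh_measurable : measurable_fun (Omega P) v.
Proof.
have mT : measurable (\bigcup_m ctri (T m) : set (mR * mR)).
  by apply: fin_bigcup_measurable => // m _; exact: measurable_ctri (tri_nondeg m).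
suff H : measurable_fun (\bigcup_m ctri (T m) : set (mR * mR)) (v : mR * mR -> mR).
  by apply: (measurable_funS mT _ H); rewrite cover_ctri; exact: subset_closure.
apply: measurable_fun_fin_bigcup => m; first exact: measurable_ctri (tri_nondeg m).
have [c0 va] := Vh_aff m.
apply: (@eq_measurable_fun _ _ _ _ _ (aff c0 (gradK m).1 (gradK m).2)).
  by move=> x; rewrite inE => xm; rewrite va.
exact: aff_measurable.
Qed.

(** The closed triangles cut the edge into finitely many closed pieces, on each of which [v] is
    affine; continuity glues over a finite closed cover. *)
Lemma Vh_edge_continuous i : {within I01 (R := R), continuous (v \o edge P i)}.
Proof.
have cE : continuous (edge P i) by rewrite edge_segpt; exact: segpt_continuous.
pose F m := I01 (R := R) `&` edge P i @^-1` ctri (T m).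
have cF m : closed (F m).
  apply: closedI; first exact: itv_closed.
  apply: preimage_closed => [t _|]; first exact: cE.
  exact/closed_ctri/tri_nondeg.
have -> : I01 (R := R) = \bigcup_m F m.
  apply/seteqP; split => [t t01|t [m _ []]] //.
  have : closure (Omega P) (edge P i t).
    by apply: edge_closure; move: t01; rewrite /I01 /= in_itv.
  by rewrite -cover_ctri => -[m _ tm]; exists m.
suff [] : closed (\bigcup_m F m) /\
  {within \bigcup_m F m, continuous (v \o edge P i)} by [].
rewrite bigcup_finE; elim/big_ind: _.
- by split; [exact: closed0|exact: continuous_subspace0].
- move=> A B [cA fA] [cB fB]; split; first exact: closedU.
  exact: withinU_continuous.
- move=> m _; split => //; have [c0 va] := Vh_aff m.
  apply: (@subspace_eq_continuous _ _ _ (aff c0 (gradK m).1 (gradK m).2 \o edge P i)).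
    by move=> t; rewrite inE => -[_ tm]; exact/esym/va.
  apply: continuous_subspaceT => t; apply: continuous_comp; first exact: cE.
  exact: aff_continuous.
Qed.

(* A segment in the convex set [closure Omega] is a connected set covered by
   finitely many closed pieces on each of which [v] is constant. *)
Lemma Vh_constant : (forall m, gradK m = (0, 0)) ->
  forall x y, closure (Omega P) x -> closure (Omega P) y -> v x = v y.
Proof.
move=> g0 x y xO yO.
have vc m : exists c, forall z, ctri (T m) z -> v z = c.
  have [c0 va] := Vh_aff m; exists c0 => z /va ->.
  by rewrite g0 /aff !mul0r !addr0.
have /choice[c vE] := vc.
pose G m := segpt x y @^-1` ctri (T m).
have cG m : closed (G m).
  apply: preimage_closed => [t _|]; first exact: segpt_continuous.
  exact/closed_ctri/tri_nondeg.
pose S := [set t : R | t \in `[0, 1] /\ v (segpt x y t) = v x].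
have cov (t : R) : t \in `[0, 1] -> exists m, G m t.
  rewrite in_itv => t01; have := closure_Omega_segpt t01 xO yO.
  by rewrite -cover_ctri => -[m _ tm]; exists m.
suff : S = [set` `[0, 1]].
  move=> SE; have : S 1 by rewrite SE /= in_itv /= ler01 lexx.
  by rewrite /S /= segpt1 => -[_ ->].
apply: (@segment_connected R 0 1).
- by exists 0; split; rewrite ?segpt0 // in_itv /= ler01 lexx.
(* [S] is relatively open: its complement in the segment is covered by the finitely many closed
   pieces whose constant differs from [v x]. *)
- exists (~` \bigcup_(m in [set m | c m != v x]) G m).
    by rewrite openC; apply: closed_bigcup => //; exact: finite_finset.
  apply/seteqP; split => t.
    move=> [t01 tx]; split => // -[m /= /eqP cm Gm]; apply: cm.
    by rewrite -tx (vE m).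
  move=> [t01 tn]; split => //; have [m Gm] := cov t t01.
  rewrite (vE m) //; apply/eqP; apply: contrapT => /negP cm; apply: tn.
  by exists m.
- exists (\bigcup_(m in [set m | c m == v x]) G m).
    by apply: closed_bigcup => //; exact: finite_finset.
  apply/seteqP; split => t.
    move=> [t01 tx]; split => //; have [m Gm] := cov t t01; exists m => //=.
    by rewrite -tx (vE m).
  by move=> [t01 [m /= /eqP cm Gm]]; split => //; rewrite (vE m).
Qed.

(** Equality holds on the whole plane because functions of [Vh] are extended by 0 off the closed
    polygon. *)
Lemma Vh_eq0 : (forall m k, v (T m k) = 0) -> v = 0.
Proof.
move=> v0; apply/funext => x; have [_ vO] := Vv.
have [|/vO //] := pselect (closure (Omega P) x).
rewrite -cover_ctri => -[m _ /Vh_bary ->].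
by rewrite big1 // => k _; rewrite v0 mulr0.
Qed.

End FiniteElementFunction.
End ConvexPolygon.

(** * Integrals over the domain and its boundary *)

Section Integrability.
Context d (T : measurableType d) (R : realType) (mu : {measure set T -> \bar R}).

Lemma integrable_cst_on (D : set T) (c : R) :
  measurable D -> (mu D < +oo)%E -> mu.-integrable D (EFin \o cst c).
Proof.
move=> mD Dy; apply/integrableP; split; first exact/measurable_EFinP.
rewrite (eq_integral (fun=> `|c|%:E)) // integral_cst //.
by rewrite lte_mul_pinfty // ltry.
Qed.

Lemma integrable_bounded_mul (D : set T) (f v : T -> R) (b : R) :
  measurable D -> mu.-integrable D (EFin \o f) -> measurable_fun D v ->
  (forall x, D x -> `|v x| <= b) ->
  mu.-integrable D (EFin \o (fun x => f x * v x)).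
Proof.
move=> mD fi mv vb; have /integrableP[/measurable_EFinP mf _] := fi.
apply: (@le_integrable _ _ _ mu D mD _ (fun x => b%:E * (EFin \o f) x)%E).
- by apply/measurable_EFinP; exact: measurable_funM.
- move=> x Dx; rewrite /= lee_fin !normrM mulrC ler_wpM2r //.
  exact: le_trans (vb _ Dx) (ler_norm _).
- exact: integrableZl.
Qed.

(** Domination by [1 + f ^+ 2], whose constant part is integrable because [D] has finite measure. *)
Lemma integrable_sqr (D : set T) (f : T -> R) :
  measurable D -> (mu D < +oo)%E -> measurable_fun D f ->
  (\int[mu]_(x in D) ((f x) ^+ 2)%:E < +oo)%E ->
  mu.-integrable D (EFin \o f).
Proof.
move=> mD muD mf f2.
pose one : T -> R := cst 1; pose ff : T -> R := fun x => f x ^+ 2.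
have i1 : mu.-integrable D (EFin \o one) by exact: integrable_cst_on.
have i2 : mu.-integrable D (EFin \o ff).
  apply/integrableP; split.
    by apply/measurable_EFinP; exact: measurable_funX.
  rewrite (eq_integral (fun x => ((f x) ^+ 2)%:E)) // => x _.
  by rewrite /= ger0_norm // sqr_ge0.
apply: (@le_integrable _ _ _ mu D mD _ ((EFin \o one) \+ (EFin \o ff))%E).
- exact/measurable_EFinP.
- move=> x Dx; rewrite /= lee_fin [leRHS]ger0_norm ?addr_ge0 ?sqr_ge0 //.
  rewrite /one /ff /cst -(real_normK (num_real (f x))).
  have := sqr_ge0 (`|f x| - 1); have := normr_ge0 (f x); nra.
- exact: integrableD.
Qed.

End Integrability.

Section BoundaryIntegral.
Variables (R : realType) (N : nat) (P : 'I_N -> R * R).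
Notation mu1 := (@lebesgue_measure R).
Notation bint := (bint P).
Implicit Types F G : R * R -> R.

Let mI : measurable (I01 (R := R) : set (measurableTypeR R)).
Proof. exact: measurable_itv. Qed.

Lemma lebesgue_I01 : mu1 (I01 (R := R)) = 1%:E.
Proof. by rewrite /I01 lebesgue_measure_itv /= lte_fin ltr01 oppr0 adde0. Qed.

Definition bdry_integrable F :=
  forall i, mu1.-integrable (I01 (R := R)) (EFin \o (F \o edge P i)).

Definition bdry_continuous F :=
  forall i, {within I01 (R := R), continuous (F \o edge P i)}.

Lemma bdry_continuous_integrable F : bdry_continuous F -> bdry_integrable F.
Proof.
move=> cF i; apply: continuous_compact_integrable; first exact: segment_compact.
exact: cF.
Qed.

Lemma bdry_continuousM F G : bdry_continuous F -> bdry_continuous G ->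
  bdry_continuous (fun x => F x * G x).
Proof. by move=> cF cG i t; apply: cvgM; [exact: cF|exact: cG]. Qed.

Lemma bdry_continuousD F G : bdry_continuous F -> bdry_continuous G ->
  bdry_continuous (fun x => F x + G x).
Proof. by move=> cF cG i t; apply: cvgD; [exact: cF|exact: cG]. Qed.

Lemma bdry_continuous_cst c : bdry_continuous (fun=> c).
Proof. by move=> i t; exact: cvg_cst. Qed.

Lemma C1_bdry_continuous F : C1_bdry P F -> bdry_continuous F.
Proof.
move=> F1 i; have [f [df [_ fE]]] := F1 i.
apply: (@subspace_eq_continuous _ _ _ f).
  by move=> t; rewrite inE /I01 /= in_itv => t01; exact: fE.
apply: continuous_subspaceT => t; apply: differentiable_continuous.
exact/derivable1_diffP.
Qed.

Lemma bintZD c F G : bdry_integrable F -> bdry_integrable G ->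
  bint (fun x => c * F x + G x) = c * bint F + bint G.
Proof.
move=> iF iG; rewrite /Defs.bint mulr_sumr -big_split /=; apply: eq_bigr => i _.
rewrite RintegralD //; [|exact: (integrableZl mI c (iF i))|exact: iG].
rewrite RintegralZl //; last exact: iF.
by ring.
Qed.

Lemma eq_bint F G : (forall x, bdry P x -> F x = G x) -> bint F = bint G.
Proof.
move=> FG; apply: eq_bigr => i _; congr (_ * _); apply: eq_Rintegral => t.
rewrite inE /I01 /= in_itv => t01; apply: FG.
by exists i, t; split.
Qed.

Lemma le_bint F G : bdry_integrable F -> bdry_integrable G ->
  (forall x, bdry P x -> F x <= G x) -> bint F <= bint G.
Proof.
move=> iF iG FG; apply: ler_sum => i _; apply: ler_wpM2l; first exact: sqrtr_ge0.
apply: le_Rintegral => //; [exact: iF|exact: iG|move=> t].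
by rewrite /I01 /= in_itv => t01; apply: FG; exists i, t; split.
Qed.

Lemma bint_cst c : bint (fun=> c) = c * \sum_i elen P i.
Proof.
rewrite /Defs.bint mulr_sumr; apply: eq_bigr => i _.
transitivity (elen P i * (c * fine (mu1 (I01 (R := R))))).
  by congr (_ * _); exact: Rintegral_cst.
by rewrite lebesgue_I01 mulr1 mulrC.
Qed.

Lemma bint_ge0 F : (forall x, bdry P x -> 0 <= F x) -> 0 <= bint F.
Proof.
move=> F0; apply: sumr_ge0 => i _; apply: mulr_ge0; first exact: sqrtr_ge0.
apply: Rintegral_ge0 => t; rewrite /I01 /= in_itv => t01.
by apply: F0; exists i, t; split.
Qed.

(* Both suprema in [C1_norm] are nonnegative; the first one is over a bounded
   set by compactness of the edges, hence a true upper bound. *)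
Lemma C1_norm_ge F x : C1_bdry P F -> bdry P x -> `|F x| <= C1_norm P F.
Proof.
move=> F1 Px; rewrite /C1_norm ler_wpDr //.
  set A := [set r | _]; have [[r Ar]|/set0P/negP/negPn/eqP ->] := pselect (A !=set0);
    last by rewrite sup0.
  have A0 y : A y -> 0 <= y.
    by move=> [i [t [_ ->]]]; rewrite divr_ge0 // sqrtr_ge0.
  (* An unbounded set has [sup] equal to 0 by default, so the derivative term is nonnegative in
     either case. *)
  have [hA|/sup_out -> //] := pselect (has_sup A).
  by apply: le_trans (A0 _ Ar) _; apply: ub_le_sup => //; case: hA.
apply: ub_le_sup; last by exists x.
have bnd i : exists b, forall t, 0 <= t <= 1 -> `|F (edge P i t)| <= b.
  have cF := @C1_bdry_continuous F F1 i.
  have [t0 _ mx] := @EVT_max R (fun t => `|F (edge P i t)|) 0 1 ler01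
    (fun t => cvg_norm (cF t)).
  by exists `|F (edge P i t0)| => t t01; apply: mx; rewrite in_itv.
have /choice[b bE] := bnd.
exists (\sum_i `|b i|) => _ [_ [[i [t [t01 ->]]] ->]].
apply: le_trans (bE i t t01) _; apply: le_trans (ler_norm _) _.
by rewrite (bigD1 i) //= lerDl sumr_ge0.
Qed.

End BoundaryIntegral.

Section FiniteElementIntegrals.
Variables (R : realType) (N M : nat) (P : 'I_N -> R * R).
Variable T : 'I_M -> 'I_3 -> R * R.
Hypothesis N3 : (3 <= N)%N.
Hypothesis P_convex : convex_ccw_vertices P.
Hypothesis T_tri : triangulation P T.
Notation mR := (measurableTypeR R).
Notation mu2 := (@leb2 R).

Let mO : measurable (Omega P : set (mR * mR)) := measurable_Omega P.
Let motri m : measurable (otri (T m) : set (mR * mR)) :=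
  measurable_otri (tri_nondeg T_tri m).

Lemma leb2_otri_fin m : mu2 (otri (T m)) \is a fin_num.
Proof.
rewrite ge0_fin_numE //; apply: (@le_lt_trans _ _ (mu2 (Omega P))); last first.
  exact: (leb2_Omega_lty T_tri).
by apply: le_measure; rewrite ?inE //; exact: (otri_Omega N3 P_convex T_tri).
Qed.

Definition tarea m : R := fine (mu2 (otri (T m))).

Lemma tarea_gt0 m : 0 < tarea m.
Proof.
rewrite /tarea -lte_fin fineK ?leb2_otri_fin //.
apply: leb2_open_gt0 => //; first exact: open_otri (tri_nondeg T_tri m).
exact: otri_nonempty.
Qed.

(** Up to a null set the polygon is the disjoint union of the open triangles, on each of which both
    gradients are constant. *)
Lemma Rintegral_grad u v : Vh P T u -> Vh P T v ->
  Rintegral mu2 (Omega P) (fun x => dot (grad u x) (grad v x)) =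
  \sum_m tarea m * dot (gradK T u m) (gradK T v m).
Proof.
move=> Vu Vv; pose f x := dot (grad u x) (grad v x).
have fE m x : otri (T m) x -> f x = dot (gradK T u m) (gradK T v m).
  by move=> xm; rewrite /f (Vh_grad T_tri Vu xm) (Vh_grad T_tri Vv xm).
have mU : measurable (\bigcup_m otri (T m) : set (mR * mR)).
  exact: fin_bigcup_measurable.
have Omega0 := Omega_diff_otri_null T_tri.
rewrite /Rintegral (@integral_setD_null _ _ _ mu2 _ _ _ _ Omega0);
  last exact: measurableD.
rewrite setDD setIidr; last first.
  by move=> x [m _]; exact: (otri_Omega N3 P_convex T_tri).
rewrite bigcup_finE (integral_bigsetU_EFin mu2 motri (index_enum_uniq _)); last 2 first.
- apply/trivIsetP => i j _ _ ij; have [_ [_ [disj _]]] := T_tri.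
  exact: disj.
- rewrite -bigcup_finE; apply/measurable_EFinP.
  apply: measurable_fun_fin_bigcup => // m.
  apply: (@eq_measurable_fun _ _ _ _ _ (cst (dot (gradK T u m) (gradK T v m)))) => //.
  by move=> x; rewrite inE => /fE.
have intE m : (\int[mu2]_(x in otri (T m)) (f x)%:E =
    (tarea m * dot (gradK T u m) (gradK T v m))%:E)%E.
  rewrite (eq_integral (fun=> (dot (gradK T u m) (gradK T v m))%:E)).
    by rewrite integral_cst // mulrC EFinM fineK ?leb2_otri_fin.
  by move=> x; rewrite inE => /fE ->.
by under eq_bigr do rewrite intE; rewrite sumEFin.
Qed.

Lemma integrable_load f v : L2_Omega P f -> Vh P T v ->
  mu2.-integrable (Omega P) (EFin \o (fun x => f x * v x)).
Proof.
move=> [mf f2] Vv; have Oy := leb2_Omega_lty T_tri.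
apply: (@integrable_bounded_mul _ _ _ _ _ _ _ (\sum_m \sum_k `|v (T m k)|)) => //.
- exact: integrable_sqr.
- exact: (Vh_measurable T_tri).
- by move=> x /subset_closure; exact: Vh_bounded.
Qed.

Lemma Vh_bdry_continuous v : Vh P T v -> bdry_continuous P v.
Proof. by move=> Vv i; exact: (Vh_edge_continuous N3 P_convex T_tri). Qed.

Lemma integrable_flux g v : H12_bdry P g -> Vh P T v ->
  bdry_integrable P (fun x => g x * v x).
Proof.
move=> [mg [g2 _]] Vv i.
have I01f : (@lebesgue_measure R (I01 (R := R)) < +oo)%E by rewrite lebesgue_I01 ltry.
have mI : measurable (I01 (R := R) : set mR) by exact: measurable_itv.
suff : (@lebesgue_measure R).-integrable (I01 (R := R))
  (EFin \o (fun t : mR => (g \o edge P i) t * (v \o edge P i) t)) by [].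
apply: (@integrable_bounded_mul _ mR R (@lebesgue_measure R) _ (g \o edge P i)
  (v \o edge P i)
  (\sum_m \sum_k `|v (T m k)|)) => //.
- apply: integrable_sqr => //; first exact: mg.
  have e0 := elen_gt0 N3 P_convex i.
  have : ((elen P i)%:E * \int[@lebesgue_measure R]_(t in I01 (R := R))
      ((g (edge P i t)) ^+ 2)%:E < +oo)%E.
    apply: le_lt_trans g2; rewrite (bigD1 i) //= leeDl //.
    apply: sume_ge0 => j _; apply: mule_ge0.
      by rewrite lee_fin sqrtr_ge0.
    by apply: integral_ge0 => t _; rewrite lee_fin sqr_ge0.
  (* Since the edge length is positive, an infinite integral would make the weighted one
     infinite. *)
  rewrite [in X in X -> _]ltey [in X in _ -> X]ltey; apply: contraNneq => /= ->.
  by rewrite mulry gtr0_sg // mul1e.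
- apply: subspace_continuous_measurable_fun => //.
  exact: (Vh_edge_continuous N3 P_convex T_tri).
- move=> t; rewrite /I01 /= in_itv => t01.
  exact/(Vh_bounded T_tri Vv)/edge_closure.
Qed.

Lemma Rintegral_sqr_le v : Vh P T v ->
  Rintegral mu2 (Omega P) (fun x => v x ^+ 2) <=
  (\sum_m \sum_k `|v (T m k)|) ^+ 2 * fine (mu2 (Omega P)).
Proof.
move=> Vv; have Oy := leb2_Omega_lty T_tri.
rewrite -(Rintegral_cst mu2 mO); apply: le_Rintegral => //.
- rewrite (_ : _ \o _ = EFin \o (fun x => v x * v x)) //.
  apply: (@integrable_bounded_mul _ _ _ mu2 _ v v (\sum_m \sum_k `|v (T m k)|)) => //.
  + apply: (@eq_integrable _ _ _ mu2 _ mO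
      (EFin \o (fun x => cst (1 : R) x * v x))) => [x _|]; first by rewrite /= mul1r.
    apply: (@integrable_bounded_mul _ _ _ _ _ _ _ (\sum_m \sum_k `|v (T m k)|)) => //.
    * exact: integrable_cst_on.
    * exact: (Vh_measurable T_tri).
    * by move=> x /subset_closure; exact: Vh_bounded.
  + exact: (Vh_measurable T_tri).
  + by move=> x /subset_closure; exact: Vh_bounded.
- exact: integrable_cst_on.
- move=> x /subset_closure/(Vh_bounded T_tri Vv) vb.
  by rewrite -(real_normK (num_real (v x))) lerXn2r ?nnegrE // (le_trans _ vb).
Qed.

End FiniteElementIntegrals.

(** * The Robin form on the finite element space *)

Section Nodal.
Variables (R : realType) (M : nat) (T : 'I_M -> 'I_3 -> R * R).

(** The evaluation map for [finite_spanning]. A shared vertex is listed once per triangle, which is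
    harmless as only injectivity on [Vh] is asked of it. *)
Definition nodal (v : R * R -> R) : 'rV[R]_#|{: 'I_M * 'I_3}| :=
  \row_j v (T (enum_val j).1 (enum_val j).2).

Lemma nodal_is_linear : linear nodal.
Proof. by move=> c u v; apply/rowP => j; rewrite !mxE. Qed.

HB.instance Definition _ :=
  GRing.isLinear.Build R (R * R -> R) 'rV[R]_#|{: 'I_M * 'I_3}| _ nodal nodal_is_linear.

End Nodal.

Section RobinForm.
Variables (R : realType) (N M : nat) (P : 'I_N -> R * R).
Variable T : 'I_M -> 'I_3 -> R * R.
Hypothesis N3 : (3 <= N)%N.
Hypothesis P_convex : convex_ccw_vertices P.
Hypothesis T_tri : triangulation P T.
Implicit Types (u v w alpha : R * R -> R).

Let bform := bform P.
Let bint := bint P.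

Lemma dotC (p q : R * R) : dot p q = dot q p.
Proof. by rewrite /dot; ring. Qed.

Lemma Vh0 : Vh P T 0.
Proof. by split => // m; exists 0, 0, 0 => x _; rewrite !mul0r !addr0. Qed.

Lemma Vh_ZD c u v : Vh P T u -> Vh P T v -> Vh P T (c *: u + v).
Proof.
move=> [Vu u0] [Vv v0]; split => [m|x xO].
  have [c0 [c1 [c2 uE]]] := Vu m; have [d0 [d1 [d2 vE]]] := Vv m.
  exists (c * c0 + d0), (c * c1 + d1), (c * c2 + d2) => x xm.
  have -> : (c *: u + v) x = c * u x + v x by [].
  by rewrite uE // vE //; ring.
have -> : (c *: u + v) x = c * u x + v x by [].
by rewrite u0 // v0 // mulr0 addr0.
Qed.

Lemma nodal_inj v : Vh P T v -> nodal T v = 0 -> v = 0.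
Proof.
move=> Vv n0; apply: (Vh_eq0 T_tri Vv) => m k.
by have /rowP/(_ (enum_rank (m, k))) := n0; rewrite !mxE enum_rankK.
Qed.

(** The gradient part of the form as a finite sum, bilinear without any integrability argument. *)
Definition dirichlet u v : R :=
  \sum_m tarea T m * dot (gradK T u m) (gradK T v m).

Lemma dirichletZD c u v w :
  dirichlet (c *: u + v) w = c * dirichlet u w + dirichlet v w.
Proof.
rewrite /dirichlet mulr_sumr -big_split; apply: eq_bigr => m _ /=.
have gE (F : 'I_3 -> R) : \sum_k (c *: u + v) (T m k) * F k =
    c * (\sum_k u (T m k) * F k) + \sum_k v (T m k) * F k.
  rewrite mulr_sumr -big_split; apply: eq_bigr => k _ /=.
  by rewrite mulrA -mulrDl.
by rewrite /dot /gradK /= !gE; ring.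
Qed.

Lemma dirichlet_ge0 v : 0 <= dirichlet v v.
Proof.
apply: sumr_ge0 => m _; rewrite mulr_ge0 ?(ltW (tarea_gt0 N3 P_convex T_tri m)) //.
by rewrite /dot addr_ge0 // -expr2 sqr_ge0.
Qed.

Lemma bformE alpha u v : Vh P T u -> Vh P T v ->
  bform alpha u v = dirichlet u v + bint (fun x => alpha x * u x * v x).
Proof.
by move=> Vu Vv; rewrite /bform /Defs.bform (Rintegral_grad N3 P_convex T_tri).
Qed.

Lemma trace_integrable alpha u v : bdry_continuous P alpha ->
  Vh P T u -> Vh P T v -> bdry_integrable P (fun x => alpha x * u x * v x).
Proof.
move=> ca Vu Vv; apply: bdry_continuous_integrable.
have cu : bdry_continuous P u by exact: (Vh_bdry_continuous N3 P_convex T_tri).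
have cv : bdry_continuous P v by exact: (Vh_bdry_continuous N3 P_convex T_tri).
by apply: bdry_continuousM => //; exact: bdry_continuousM.
Qed.

Lemma bintZ c F : bdry_integrable P F -> bint (fun x => c * F x) = c * bint F.
Proof.
move=> iF; have i0 : bdry_integrable P (fun=> 0).
  exact/bdry_continuous_integrable/bdry_continuous_cst.
have := bintZD c iF i0; rewrite bint_cst mul0r addr0 => <-.
by apply: eq_bint => x _; rewrite addr0.
Qed.

Lemma bformC alpha u v : Vh P T u -> Vh P T v -> bform alpha u v = bform alpha v u.
Proof.
move=> Vu Vv; rewrite !bformE //; congr (_ + _).
  by apply: eq_bigr => m _; rewrite dotC.
by apply: eq_bint => x _; ring.
Qed.

Lemma trace_ZDl alpha c u v w : bdry_continuous P alpha ->
  Vh P T u -> Vh P T v -> Vh P T w ->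
  bint (fun x => alpha x * (c *: u + v) x * w x) =
  c * bint (fun x => alpha x * u x * w x) + bint (fun x => alpha x * v x * w x).
Proof.
move=> ca Vu Vv Vw; rewrite -bintZD; [|exact: trace_integrable..].
apply: eq_bint => x _; have -> : (c *: u + v) x = c * u x + v x by [].
by ring.
Qed.

Lemma trace_ZDr alpha c u v w : bdry_continuous P alpha ->
  Vh P T u -> Vh P T v -> Vh P T w ->
  bint (fun x => alpha x * w x * (c *: u + v) x) =
  c * bint (fun x => alpha x * w x * u x) + bint (fun x => alpha x * w x * v x).
Proof.
move=> ca Vu Vv Vw; rewrite -bintZD; [|exact: trace_integrable..].
apply: eq_bint => x _; have -> : (c *: u + v) x = c * u x + v x by [].
by ring.
Qed.

Lemma bformZDl alpha c u v w : bdry_continuous P alpha ->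
  Vh P T u -> Vh P T v -> Vh P T w ->
  bform alpha (c *: u + v) w = c * bform alpha u w + bform alpha v w.
Proof.
move=> ca Vu Vv Vw; rewrite !bformE //; last exact: Vh_ZD.
by rewrite dirichletZD trace_ZDl //; ring.
Qed.

Lemma bformZDr alpha c u v w : bdry_continuous P alpha ->
  Vh P T u -> Vh P T v -> Vh P T w ->
  bform alpha w (c *: u + v) = c * bform alpha w u + bform alpha w v.
Proof.
move=> ca Vu Vv Vw; rewrite bformC //; last exact: Vh_ZD.
by rewrite bformZDl // ![bform alpha _ w]bformC.
Qed.

(** * Definiteness, solvability and the energy bound *)

Section Coercive.
Variables (alpha : R * R -> R) (a1 : R).
Hypothesis alpha_cont : bdry_continuous P alpha.
Hypothesis a1_gt0 : 0 < a1.
Hypothesis alpha_ge : forall x, bdry P x -> a1 <= alpha x.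

Lemma trace_sqr_le v : Vh P T v ->
  a1 * bint (fun x => v x * v x) <= bint (fun x => alpha x * v x * v x).
Proof.
move=> Vv; have cv : bdry_continuous P v.
  exact: (Vh_bdry_continuous N3 P_convex T_tri).
have iv : bdry_integrable P (fun x => v x * v x).
  exact/bdry_continuous_integrable/bdry_continuousM.
rewrite -bintZ //; apply: le_bint; last 1 first.
- move=> x /alpha_ge ax; rewrite -!mulrA ler_wpM2r // -expr2; exact: sqr_ge0.
- apply/bdry_continuous_integrable/bdry_continuousM; last exact: bdry_continuousM.
  exact: bdry_continuous_cst.
- exact: trace_integrable.
Qed.

Lemma trace_sqr_ge0 v : 0 <= bint (fun x => v x * v x).
Proof. by apply: bint_ge0 => x _; rewrite -expr2 sqr_ge0. Qed.

Lemma bform_coercive v : Vh P T v ->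
  dirichlet v v + a1 * bint (fun x => v x * v x) <= bform alpha v v.
Proof. by move=> Vv; rewrite bformE // lerD2l trace_sqr_le. Qed.

Lemma bform_ge0 v : Vh P T v -> 0 <= bform alpha v v.
Proof.
move=> Vv; apply: le_trans (bform_coercive Vv).
by rewrite addr_ge0 ?dirichlet_ge0 // mulr_ge0 ?trace_sqr_ge0 // ltW.
Qed.

Lemma bform_definite v : Vh P T v -> bform alpha v v = 0 -> v = 0.
Proof.
move=> Vv bv0; have := bform_coercive Vv; rewrite bv0.
have d0 := dirichlet_ge0 v; have t0 := trace_sqr_ge0 v => coer.
have at0 := mulr_ge0 (ltW a1_gt0) t0.
have {}d0 : dirichlet v v = 0 by apply/le_anti; rewrite d0 andbT; lra.
have {}t0 : bint (fun x => v x * v x) = 0.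
  have /eqP : a1 * bint (fun x => v x * v x) = 0 by lra.
  by rewrite mulf_eq0 gt_eqF //= => /eqP.
have g0 m : gradK T v m = (0, 0).
  have /psumr_eq0P : dirichlet v v = 0 by [].
  have ge0 (i : 'I_M) : xpredT i -> 0 <= tarea T i * dot (gradK T v i) (gradK T v i).
    move=> _; rewrite mulr_ge0 ?(ltW (tarea_gt0 N3 P_convex T_tri i)) //.
    by rewrite /dot addr_ge0 // -expr2 sqr_ge0.
  move=> /(_ ge0 m isT)/eqP; rewrite mulf_eq0.
  rewrite (gt_eqF (tarea_gt0 N3 P_convex T_tri m)) /=.
  rewrite /dot -!expr2 paddr_eq0 ?sqr_ge0 // !sqrf_eq0 => /andP[/eqP g1 /eqP g2].
  by rewrite [LHS]surjective_pairing g1 g2.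
have i0 : 'I_N by exists 0%N; lia.
pose p := edge P i0 0.
have vE := Vh_constant N3 P_convex T_tri Vv g0.
have eO i t : 0 <= t <= 1 -> closure (Omega P) (edge P i t).
  exact: edge_closure.
have pO : closure (Omega P) p by apply: eO; rewrite lexx ler01.
(* As [v] is constant on the closed polygon, its boundary integral is [v p ^+ 2] times the
   perimeter, which is positive. *)
have : bint (fun=> v p * v p) = 0.
  rewrite -t0; apply: eq_bint => _ [i [t [t01 ->]]].
  by rewrite (vE _ _ pO (eO i t t01)).
rewrite /bint bint_cst => /eqP; rewrite mulf_eq0 -expr2 sqrf_eq0 => /orP[/eqP vp|].
  apply: (Vh_eq0 T_tri Vv) => m k; rewrite -vp; apply: vE => //.
  by apply: (ctri_closure T_tri (m := m)); apply: vertex_ctri; exact: (tri_nondeg T_tri).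
rewrite psumr_eq0 => [/allP/(_ i0)|i _]; last exact: sqrtr_ge0.
by rewrite mem_index_enum => /(_ isT); rewrite gt_eqF //; exact: elen_gt0.
Qed.

(** Stated for an arbitrary linear functional to serve the state equation, the derivative equation
    and the Riesz representation of nodal values alike. *)
Lemma bform_solvable (l : (R * R -> R) -> R) :
  (forall c u v, Vh P T u -> Vh P T v -> l (c *: u + v) = c * l u + l v) ->
  exists! u, Vh P T u /\ forall v, Vh P T v -> bform alpha u v = l v.
Proof.
move=> lin.
have [u Vu bu] := definite_form_solvable Vh0 Vh_ZD nodal_inj
  (fun c u v w => @bformZDl alpha c u v w alpha_cont)
  (fun c u v w => @bformZDr alpha c u v w alpha_cont) bform_definite lin.
exists u; split => // u' [Vu' bu'].
have Vw : Vh P T (-1 *: u' + u) by exact: Vh_ZD.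
have : -1 *: u' + u = 0.
  by apply: bform_definite => //; rewrite bformZDl // bu // bu' //; ring.
by rewrite scaleN1r addrC => /eqP; rewrite subr_eq0 => /eqP.
Qed.

Lemma bform_cauchy_schwarz u v : Vh P T u -> Vh P T v ->
  bform alpha u v ^+ 2 <= bform alpha u u * bform alpha v v.
Proof.
move=> Vu Vv; have := bform_ge0 Vu; rewrite le_eqVlt => /predU1P[/esym uu0|uu_gt0].
  have -> : bform alpha u v = 0.
    have -> : u = 0 *: u + 0 by rewrite (bform_definite Vu uu0) scaler0 addr0.
    rewrite bformZDl //; last exact: Vh0.
    have := bformZDl 1 alpha_cont Vh0 Vh0 Vv; rewrite scaler0 addr0 mul1r.
    by rewrite (bform_definite Vu uu0); lra.
  by rewrite uu0 expr0n mul0r.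
(* The projection coefficient of [v] on [u]: nonnegative energy of [v - t u] is the claim. *)
set t := bform alpha u v / bform alpha u u.
have := bform_ge0 (Vh_ZD (- t) Vu Vv).
have Vw := Vh_ZD (- t) Vu Vv.
rewrite bformZDl // !bformZDr // [bform alpha v u]bformC //.
have tE : bform alpha u v = t * bform alpha u u by rewrite /t divfK // gt_eqF.
by rewrite tE => h; nra.
Qed.

(* Nodal values are represented by elements of [Vh] (Riesz), so they are
   controlled by the energy without any appeal to compactness. *)
Lemma H1_norm_le_bform : exists2 C, 0 <= C & forall v, Vh P T v ->
  H1_norm P v ^+ 2 <= C * bform alpha v v.
Proof.
have riesz mk : exists z, Vh P T z /\
    forall v, Vh P T v -> bform alpha z v = v (T mk.1 mk.2).
  by have [z [zP _]] := bform_solvable (l := fun v => v (T mk.1 mk.2))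
    (fun c u v _ _ => erefl); exists z.
have /choice[z zP] := riesz.
pose C1 := \sum_m \sum_k Num.sqrt (bform alpha (z (m, k)) (z (m, k))).
pose A := fine (leb2 (Omega P)).
have A0 : 0 <= A by rewrite fine_ge0.
(* [C1 ^+ 2 * A] bounds the L2 part through the nodal values and the area; the 1 is for the gradient
   part, which the energy dominates directly. *)
exists (C1 ^+ 2 * A + 1); first by rewrite addr_ge0 // mulr_ge0 ?sqr_ge0.
move=> v Vv; have b0 := bform_ge0 Vv.
have S1 : \sum_m \sum_k `|v (T m k)| <= C1 * Num.sqrt (bform alpha v v).
  rewrite mulr_suml; apply: ler_sum => m _; rewrite mulr_suml; apply: ler_sum => k _.
  have [Vz <-//] := zP (m, k).
  rewrite -sqrtrM ?bform_ge0 // -sqrtr_sqr ler_sqrt ?bform_cauchy_schwarz //.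
  by rewrite mulr_ge0 // bform_ge0.
have S0 : 0 <= \sum_m \sum_k `|v (T m k)|.
  by apply: sumr_ge0 => m _; apply: sumr_ge0.
have L2 := Rintegral_sqr_le T_tri Vv.
have L20 : 0 <= Rintegral (@leb2 R) (Omega P) (fun x => v x ^+ 2).
  by apply: Rintegral_ge0 => x _; exact: sqr_ge0.
have D0 := dirichlet_ge0 v.
have DE : Rintegral (@leb2 R) (Omega P) (fun x => dot (grad v x) (grad v x)) =
  dirichlet v v by exact: (Rintegral_grad N3 P_convex T_tri).
rewrite /H1_norm sqr_sqrtr ?DE ?addr_ge0 // mulrDl mul1r lerD //.
  apply: le_trans L2 _; rewrite -/A [leRHS]mulrAC ler_wpM2r //.
  rewrite -[X in _ <= _ * X](sqr_sqrtr b0) -exprMn lerXn2r ?nnegrE //.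
  exact: le_trans S1.
apply: le_trans (bform_coercive Vv); rewrite lerDl mulr_ge0 ?trace_sqr_ge0 //.
exact: ltW.
Qed.

End Coercive.

Lemma lformZD f g c u v : L2_Omega P f -> H12_bdry P g ->
  Vh P T u -> Vh P T v ->
  lform P f g (c *: u + v) = c * lform P f g u + lform P f g v.
Proof.
move=> f2 g2 Vu Vv; rewrite /lform.
have -> : Defs.bint P (fun x => g x * (c *: u + v) x) =
    c * bint (fun x => g x * u x) + bint (fun x => g x * v x).
  rewrite -bintZD; [|exact: (integrable_flux N3 P_convex T_tri)..].
  apply: eq_bint => x _; have -> : (c *: u + v) x = c * u x + v x by [].
  by ring.
have fu := integrable_load T_tri f2 Vu.
have fv := integrable_load T_tri f2 Vv.
have mO := measurable_Omega P.
have -> : Rintegral (@leb2 R) (Omega P) (fun x => f x * (c *: u + v) x) =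
    c * Rintegral (@leb2 R) (Omega P) (fun x => f x * u x) +
    Rintegral (@leb2 R) (Omega P) (fun x => f x * v x).
  rewrite -RintegralZl // -RintegralD //; last exact: (integrableZl mO c fu).
  apply: eq_Rintegral => x _; have -> : (c *: u + v) x = c * u x + v x by [].
  by ring.
by rewrite -/bint; ring.
Qed.

End RobinForm.

(** Young's inequality by completing a square. The free weight [a] allows the [z] term to be
    absorbed later by coercivity. *)
Lemma young_product (R : realType) (h k a y z : R) : 0 < a -> `|h| <= k ->
  - (h * y * z) <= k ^+ 2 / (2 * a) * y ^+ 2 + a / 2 * z ^+ 2.
Proof.
move=> a0 hk.
have h1 : - (h * y * z) <= k * `|y| * `|z|.
  apply: le_trans (ler_norm _) _; rewrite normrN !normrM.
  by rewrite !ler_wpM2r.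
apply: le_trans h1 _.
rewrite -(real_normK (num_real y)) -(real_normK (num_real z)).
rewrite -subr_ge0.
have -> : k ^+ 2 / (2 * a) * `|y| ^+ 2 + a / 2 * `|z| ^+ 2 - k * `|y| * `|z| =
  (k * `|y| - a * `|z|) ^+ 2 / (2 * a) by field; lra.
by rewrite divr_ge0 ?sqr_ge0 // mulr_ge0 ?ltW.
Qed.

(** * Linearization in the Robin parameter *)

Section Linearization.
Variables (R : realType) (N M : nat) (P : 'I_N -> R * R).
Variable T : 'I_M -> 'I_3 -> R * R.
Hypothesis N3 : (3 <= N)%N.
Hypothesis P_convex : convex_ccw_vertices P.
Hypothesis T_tri : triangulation P T.
Variables (a : R * R -> R) (a0 : R).
Hypothesis a_cont : bdry_continuous P a.
Hypothesis a0_gt0 : 0 < a0.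
Hypothesis a_ge : forall x, bdry P x -> a0 <= a x.

Let bform := bform P.
Let bint := bint P.
Let Q v := bint (fun x => v x * v x).

Lemma trace_perturbation_le (h u v : R * R -> R) (k c : R) :
  bdry_continuous P h -> Vh P T u -> Vh P T v -> 0 < c ->
  (forall x, bdry P x -> `|h x| <= k) ->
  - bint (fun x => h x * u x * v x) <= k ^+ 2 / (2 * c) * Q u + c / 2 * Q v.
Proof.
move=> ch Vu Vv c0 hk.
have cu : bdry_continuous P u by exact: (Vh_bdry_continuous N3 P_convex T_tri).
have cv : bdry_continuous P v by exact: (Vh_bdry_continuous N3 P_convex T_tri).
have iu : bdry_integrable P (fun x => u x * u x).
  exact/bdry_continuous_integrable/bdry_continuousM.
have iv : bdry_integrable P (fun x => v x * v x).
  exact/bdry_continuous_integrable/bdry_continuousM.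
have ivc : bdry_integrable P (fun x => c / 2 * (v x * v x)).
  apply/bdry_continuous_integrable/bdry_continuousM; last exact: bdry_continuousM.
  exact: bdry_continuous_cst.
have ih : bdry_integrable P (fun x => h x * u x * v x).
  exact: (trace_integrable N3 P_convex T_tri).
rewrite -mulN1r -bintZ // /Q -(bintZ (c / 2)) // -bintZD //.
apply: le_bint.
- apply/bdry_continuous_integrable/bdry_continuousM; first exact: bdry_continuous_cst.
  by apply: bdry_continuousM => //; exact: bdry_continuousM.
- apply/bdry_continuous_integrable/bdry_continuousD.
    apply: bdry_continuousM; [exact: bdry_continuous_cst|exact: bdry_continuousM].
  apply: bdry_continuousM; [exact: bdry_continuous_cst|exact: bdry_continuousM].
- by move=> x /hk hx; rewrite mulN1r -!expr2; exact: young_product.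
Qed.

Variables (eta u0 ueta w : R * R -> R) (l : (R * R -> R) -> R) (k : R).
Hypothesis eta_cont : bdry_continuous P eta.
Hypothesis eta_le : forall x, bdry P x -> `|eta x| <= k.
Hypothesis Vu0 : Vh P T u0.
Hypothesis u0P : forall v, Vh P T v -> bform a u0 v = l v.
Hypothesis Vueta : Vh P T ueta.
Hypothesis uetaP : forall v, Vh P T v -> bform (a \+ eta) ueta v = l v.
Hypothesis Vw : Vh P T w.
Hypothesis wP : forall v, Vh P T v ->
  bform a w v = - bint (fun x => eta x * u0 x * v x).

(** The shape [c *: u + v] is the one the linearity lemmas accept. *)
Let e := -1 *: u0 + ueta.
Let r := -1 *: w + e.

Lemma Vh_increment : Vh P T e. Proof. exact: Vh_ZD. Qed.
Lemma Vh_remainder : Vh P T r.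
Proof. by apply: Vh_ZD => //; exact: Vh_increment. Qed.

Lemma bform_perturbed v : Vh P T v ->
  bform (a \+ eta) ueta v = bform a ueta v + bint (fun x => eta x * ueta x * v x).
Proof.
move=> Vv; rewrite /bform !(bformE N3 P_convex T_tri) // -addrA; congr (_ + _).
have i1 := trace_integrable N3 P_convex T_tri a_cont Vueta Vv.
have i2 := trace_integrable N3 P_convex T_tri eta_cont Vueta Vv.
rewrite -[X in X + _]mul1r -bintZD //; apply: eq_bint => x _ /=; ring.
Qed.

Lemma bform_increment v : Vh P T v ->
  bform a e v = - bint (fun x => eta x * ueta x * v x).
Proof.
move=> Vv; rewrite /bform /e (bformZDl N3 P_convex T_tri) // -/bform u0P //.
by rewrite -(uetaP Vv) bform_perturbed //; ring.
Qed.

Lemma bform_remainder v : Vh P T v ->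
  bform a r v = - bint (fun x => eta x * e x * v x).
Proof.
move=> Vv; have Ve := Vh_increment.
rewrite /bform /r (bformZDl N3 P_convex T_tri) // -/bform bform_increment //.
rewrite wP // /e /bint (trace_ZDl N3 P_convex T_tri) // -/bint; ring.
Qed.

Lemma increment_le : k <= a0 / 4 -> Q e <= 2 * k ^+ 2 / a0 ^+ 2 * Q u0.
Proof.
move=> ka; have Ve := Vh_increment; have a0_pos := a0_gt0.
(* Splitting [ueta] leaves two perturbation terms. Weight [a0 / 2] on the [u0] term costs
   [a0 / 4 * Q e]; weight [a0 / 4] on the [e] term, where [|eta| <= a0 / 4], costs twice
   [a0 / 8 * Q e]. Half of the coercivity term [a0 * Q e] survives. *)
have uE : ueta = 1 *: u0 + e by rewrite scale1r /e scaleN1r addNKr.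
have lower := bform_coercive N3 P_convex T_tri a_cont a_ge Ve.
have D0 := dirichlet_ge0 N3 P_convex T_tri e.
rewrite -/bform bform_increment // {1}uE in lower.
rewrite /bint (trace_ZDl N3 P_convex T_tri) // -/bint in lower.
have c0 : 0 < a0 / 2 by lra.
have y1 := trace_perturbation_le eta_cont Vu0 Ve c0 eta_le.
have ka' x : bdry P x -> `|eta x| <= a0 / 4 by move=> /eta_le/le_trans; apply.
have c1 : 0 < a0 / 4 by lra.
have y2 := trace_perturbation_le eta_cont Ve Ve c1 ka'.
have e1 : k ^+ 2 / (2 * (a0 / 2)) = k ^+ 2 / a0 by field; lra.
have e2 : (a0 / 4) ^+ 2 / (2 * (a0 / 4)) = a0 / 8 by field; lra.
rewrite e1 in y1; rewrite e2 in y2; rewrite -/(Q e) in lower.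
have : a0 / 2 * Q e <= k ^+ 2 / a0 * Q u0 by lra.
rewrite -ler_pdivlMl // => /le_trans; apply.
by rewrite le_eqVlt; apply/orP; left; apply/eqP; field; lra.
Qed.

Lemma remainder_le : k <= a0 / 4 ->
  bform a r r <= 2 * k ^+ 4 / a0 ^+ 3 * Q u0.
Proof.
move=> ka; have Vr := Vh_remainder; have Ve := Vh_increment; have a0_pos := a0_gt0.
have lower := bform_coercive N3 P_convex T_tri a_cont a_ge Vr.
have D0 := dirichlet_ge0 N3 P_convex T_tri r.
(* Weight [a0] produces [a0 / 2 * Q r], at most half of [bform a r r], hence absorbed on the
   left. *)
have y := trace_perturbation_le eta_cont Ve Vr a0_gt0 eta_le.
rewrite -bform_remainder // in y; rewrite -/bform -/bint -/(Q r) in lower.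
have Qe := increment_le ka.
have : bform a r r <= k ^+ 2 / a0 * Q e.
  have -> : k ^+ 2 / a0 = 2 * (k ^+ 2 / (2 * a0)) by field; lra.
  by rewrite -mulrA; lra.
move=> /le_trans; apply.
have -> : 2 * k ^+ 4 / a0 ^+ 3 * Q u0 =
  k ^+ 2 / a0 * (2 * k ^+ 2 / a0 ^+ 2 * Q u0) by field; lra.
by rewrite ler_wpM2l // divr_ge0 ?sqr_ge0 // ltW.
Qed.

End Linearization.

(** * Well-posedness and Fréchet differentiability *)

Theorem theorem3p3 (R : realType) (N M : nat) (P : 'I_N -> R * R)
    (T : 'I_M -> 'I_3 -> R * R) (f g a : R * R -> R) (a0 : R) :
  (3 <= N)%N -> convex_ccw_vertices P -> triangulation P T ->
  L2_Omega P f -> H12_bdry P g ->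
  0 < a0 -> C1_bdry P a -> (forall x, bdry P x -> a0 <= a x) ->
  (* well-posedness of u_h^{(a)}, of \dot u_h^{(a)}[eta], and of U_a near 0 *)
  (exists! u, dsol P T f g a u) /\
  (forall u0, dsol P T f g a u0 ->
     forall eta, C1_bdry P eta -> exists! w, dderiv P T a u0 eta w) /\
  (exists2 d : R, 0 < d & forall eta, C1_bdry P eta -> C1_norm P eta < d ->
     exists! u, dsol P T f g (a \+ eta) u) /\
  (* Frechet differentiability: U_a'(0) eta = \dot u_h^{(a)}[eta] *)
  (forall eps : R, 0 < eps -> exists2 d : R, 0 < d &
     forall eta, C1_bdry P eta -> 0 < C1_norm P eta < d ->
     forall u0 ueta w,
       dsol P T f g a u0 -> dsol P T f g (a \+ eta) ueta ->
       dderiv P T a u0 eta w ->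
       H1_norm P (fun x => ueta x - u0 x - w x) <= eps * C1_norm P eta).
Proof.
move=> N3 P_convex T_tri f2 g2 a0_gt0 a1 a_ge.
have ca := C1_bdry_continuous a1.
have lin c u v (Vu : Vh P T u) (Vv : Vh P T v) :=
  lformZD N3 P_convex T_tri c f2 g2 Vu Vv.
have wp := bform_solvable N3 P_convex T_tri ca a0_gt0 a_ge lin.
split; first exact: wp.
split.
  move=> u0 [Vu0 _] eta eta1; have ceta := C1_bdry_continuous eta1.
  apply: (bform_solvable N3 P_convex T_tri ca a0_gt0 a_ge) => c u v Vu Vv.
  by rewrite (trace_ZDr N3 P_convex T_tri) //; ring.
split.
  (* Within this radius [a + eta] stays above [a0 / 2] on the boundary, so the perturbed form is
     still definite. *)
  exists (a0 / 2); first by lra.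
  move=> eta eta1 etad; have ceta := C1_bdry_continuous eta1.
  apply: (@bform_solvable _ _ _ _ _ N3 P_convex T_tri (a \+ eta) (a0 / 2)) => //.
  - exact: bdry_continuousD.
  - by lra.
  - move=> x Px; have := C1_norm_ge eta1 Px; have := a_ge x Px => /=.
    by have := ler_norm (- eta x); rewrite normrN; lra.
move=> eps eps0.
(* The radius must be chosen before [u0] is given, so the constants are built from the unique
   solution [us], identified with [u0] afterwards. *)
have [us [[Vus usP] us_uniq]] := wp.
have [C C0 H1C] := H1_norm_le_bform N3 P_convex T_tri ca a0_gt0 a_ge.
pose q := bint P (fun x => us x * us x).
have q0 : 0 <= q by exact: trace_sqr_ge0.
(* [k ^+ 4 * K] bounds the squared H1 remainder. The summand 1 makes [K] positive for the division
   and gives [K <= K ^+ 2]. *)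
pose K := C * (2 / a0 ^+ 3 * q) + 1.
have K1 : 1 <= K.
  by rewrite /K lerDr !mulr_ge0 // invr_ge0 exprn_ge0 // ltW.
(* The first bound is the smallness condition of [remainder_le]; the second gives [k * K <= eps],
   whence [k ^+ 2 * K <= (k * K) ^+ 2 <= eps ^+ 2]. *)
exists (Num.min (a0 / 4) (eps / K)).
  by rewrite lt_min divr_gt0 //= ?divr_gt0 //; lra.
move=> eta eta1 /andP[k0]; rewrite lt_min => /andP[ka keps] u0 ueta w u0P uetaP wP.
have ceta := C1_bdry_continuous eta1.
set k := C1_norm P eta in k0 ka keps *.
have etak x : bdry P x -> `|eta x| <= k by exact: C1_norm_ge.
have u0E : us = u0 by exact: us_uniq.
have [Vu0 bu0] := u0P; have [Vueta bueta] := uetaP; have [Vw bw] := wP.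
have rE : (fun x => ueta x - u0 x - w x) = -1 *: w + (-1 *: u0 + ueta).
  rewrite !scaleN1r; apply/funext => x.
  have -> : (- w + (- u0 + ueta)) x = - w x + (- u0 x + ueta x) by [].
  by ring.
have rle := remainder_le N3 P_convex T_tri ca a0_gt0 a_ge ceta etak
  Vu0 bu0 Vueta bueta Vw bw (ltW ka).
have Vr := Vh_remainder Vu0 Vueta Vw.
have := H1C _ Vr; rewrite -rE => H1r; rewrite -rE in rle.
have hK : C * bform P a (fun x => ueta x - u0 x - w x)
    (fun x => ueta x - u0 x - w x) <= k ^+ 4 * K.
  apply: le_trans (ler_wpM2l C0 rle) _; rewrite -u0E -/q.
  rewrite /K mulrDr mulr1.
  have -> : C * (2 * k ^+ 4 / a0 ^+ 3 * q) = k ^+ 4 * (C * (2 / a0 ^+ 3 * q)) by ring.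
  by rewrite lerDl exprn_ge0 // ltW.
have K0 : 0 < K by lra.
have kK : k * K <= eps by rewrite -ler_pdivlMr // ltW.
rewrite -(@ler_pXn2r _ 2) ?nnegrE ?sqrtr_ge0 ?mulr_ge0 ?(ltW eps0) ?(ltW k0) //.
apply: le_trans H1r (le_trans hK _).
have -> : (eps * k) ^+ 2 = k ^+ 2 * eps ^+ 2 by ring.
have -> : k ^+ 4 * K = k ^+ 2 * (k ^+ 2 * K) by ring.
rewrite ler_wpM2l ?sqr_ge0 //.
apply: (@le_trans _ _ ((k * K) ^+ 2)).
  have -> : (k * K) ^+ 2 = k ^+ 2 * K * K by ring.
  by rewrite ler_peMr // mulr_ge0 ?sqr_ge0 // ltW.
by rewrite lerXn2r ?nnegrE ?mulr_ge0 ?(ltW k0) ?(ltW K0) ?(ltW eps0).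
Qed.
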